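(* Let $H^2_{\beta}$ be a weighted Hardy space of polynomial growth. If $\varphi$ is an elliptic disk automorphism with fixed point $\alpha$ in $\mathbb{D}$, then $C_{\varphi}$ acting on $H^2_{\beta}$ is a diagonal operator and hence it is a normal operator. Moreover, the spectrum of $C_{\varphi}$ acting on $H^2_{\beta}$ is $$\sigma(C_{\varphi})=\overline{\{(\varphi'(\alpha))^n;\ n=0,1,2,\ldots\}}.$$
   Context: $\mathbb{D}$ is the open unit disk. Let $w=\{w_k\}_{k\ge1}$ be a sequence of positive numbers with $w_k\to1$, and put $\beta_0=1$, $\beta_k=\prod_{j=1}^k w_j$. The weighted Hardy space $H^2_\beta$ is the Hilbert space of analytic functions $f(z)=\sum_{k\ge0}\widehat f(k)z^k$ on $\mathbb{D}$ with $\|f\|_{H^2_\beta}^2=\sum_{k\ge0}|\widehat f(k)|^2\beta_k^2<\infty$. It is of polynomial growth if $\sup_k (k+1)|w_k-1|<\infty$. A disk automorphism is an analytic bijection $\mathbb{D}\to\mathbb{D}$, i.e. a map $z\mapsto e^{i\theta}\frac{z_0-z}{1-\overline{z_0}z}$ with $\theta\in\mathbb{R}$ and $z_0\in\mathbb{D}$; it is elliptic if it has one fixed point in $\mathbb{D}$ and one in the complement of $\overline{\mathbb{D}}$ (possibly $\infty$). The composition operator is $C_\varphi f=f\circ\varphi$, and $\sigma(C_\varphi)$ denotes its spectrum as an operator on $H^2_\beta$.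
   Formalization: ''Diagonal, hence normal'' is false when α≠0, since normality forces φ(0)=0. It is stated instead for an inner product on H²_β whose norm is equivalent to the original norm, and which is the original inner product when α=0. *)

(* Defs.v *)
From Stdlib Require Export Reals ClassicalEpsilon.
From Coquelicot Require Export Coquelicot.

Open Scope R_scope.

(** * Functions on the open unit disk *)

Definition disk : Type := {z : C | Cmod z < 1}.
Definition disk_val (z : disk) : C := proj1_sig z.
Coercion disk_val : disk >-> C.

Definition dfun : Type := disk -> C.

Definition dzero : dfun := fun _ => RtoC 0.
Definition dplus (f g : dfun) : dfun := fun z => (f z + g z)%C.
Definition dscal (c : C) (f : dfun) : dfun := fun z => (c * f z)%C.
Definition dminus (f g : dfun) : dfun := fun z => (f z - g z)%C.

(** The value chosen outside the disk is irrelevant: the disk is open and the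
    derivative is only taken at its points. *)
Definition dextend (f : dfun) (z : C) : C :=
  match Rlt_dec (Cmod z) 1 with
  | left h => f (exist _ z h)
  | right _ => RtoC 0
  end.

Definition dderive (f : dfun) (a : disk) : C := C_derive (dextend f) a.

(** * Weighted Hardy spaces *)

Definition has_taylor (a : nat -> C) (f : dfun) : Prop :=
  forall z : disk,
    @is_pseries C_AbsRing C_NormedModule a (disk_val z) (f z).

Definition taylor (f : dfun) : nat -> C :=
  epsilon (inhabits (fun _ : nat => RtoC 0)) (fun a => has_taylor a f).

(** Weights are [w 1, w 2, ...]; the value [w 0] is never used. *)
Fixpoint beta (w : nat -> R) (k : nat) : R :=
  match k with
  | O => 1
  | S j => beta w j * w (S j)
  end.

Definition is_weight (w : nat -> R) : Prop :=
  (forall k, (1 <= k)%nat -> 0 < w k) /\ is_lim_seq w 1.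

Definition polynomial_growth (w : nat -> R) : Prop :=
  exists M : R, forall k, (1 <= k)%nat -> (INR k + 1) * Rabs (w k - 1) <= M.

Definition hardy (w : nat -> R) (f : dfun) : Prop :=
  has_taylor (taylor f) f /\
  ex_series (fun k => Cmod (taylor f k) ^ 2 * beta w k ^ 2).

Definition hardy_norm (w : nat -> R) (f : dfun) : R :=
  sqrt (Series (fun k => Cmod (taylor f k) ^ 2 * beta w k ^ 2)).

Definition hardy_ip (w : nat -> R) (f g : dfun) : C :=
  let u k := (taylor f k * Cconj (taylor g k) * RtoC (beta w k ^ 2))%C in
  (Series (fun k => Re (u k)), Series (fun k => Im (u k))).

(** * Operators on a linear space [H] of functions on the disk

    An operator is a total map on [dfun] of which only the restriction to [H]
    matters. *)

Definition bounded_op (H : dfun -> Prop) (N : dfun -> R) (T : dfun -> dfun)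
    : Prop :=
  (forall f, H f -> H (T f)) /\
  (forall f g, H f -> H g -> T (dplus f g) = dplus (T f) (T g)) /\
  (forall c f, H f -> T (dscal c f) = dscal c (T f)) /\
  (exists M : R, forall f, H f -> N (T f) <= M * N f).

Definition spectrum (H : dfun -> Prop) (N : dfun -> R) (T : dfun -> dfun)
    (l : C) : Prop :=
  ~ exists S : dfun -> dfun,
      bounded_op H N S /\
      (forall f, H f -> S (dminus (T f) (dscal l f)) = f) /\
      (forall f, H f -> dminus (T (S f)) (dscal l (S f)) = f).

Definition inner_product (H : dfun -> Prop) (ip : dfun -> dfun -> C) : Prop :=
  (forall f g h, H f -> H g -> H h ->
     ip (dplus f g) h = (ip f h + ip g h)%C) /\
  (forall c f g, H f -> H g -> ip (dscal c f) g = (c * ip f g)%C) /\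
  (forall f g, H f -> H g -> ip g f = Cconj (ip f g)) /\
  (forall f, H f -> 0 <= Re (ip f f)) /\
  (forall f, H f -> ip f f = RtoC 0 -> f = dzero).

Definition ip_norm (ip : dfun -> dfun -> C) (f : dfun) : R :=
  sqrt (Re (ip f f)).

Definition equivalent_norms (H : dfun -> Prop) (N1 N2 : dfun -> R) : Prop :=
  exists c d : R, 0 < c /\ 0 < d /\
    forall f, H f -> c * N1 f <= N2 f <= d * N1 f.

Definition orthonormal_basis (H : dfun -> Prop) (ip : dfun -> dfun -> C)
    (e : nat -> dfun) : Prop :=
  (forall n, H (e n)) /\
  (forall n, ip (e n) (e n) = RtoC 1) /\
  (forall m n, m <> n -> ip (e m) (e n) = RtoC 0) /\
  (forall f, H f -> (forall n, ip f (e n) = RtoC 0) -> f = dzero).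

Definition diagonal_op (H : dfun -> Prop) (ip : dfun -> dfun -> C)
    (T : dfun -> dfun) : Prop :=
  bounded_op H (ip_norm ip) T /\
  exists (e : nat -> dfun) (d : nat -> C),
    orthonormal_basis H ip e /\ forall n, T (e n) = dscal (d n) (e n).

Definition normal_op (H : dfun -> Prop) (ip : dfun -> dfun -> C)
    (T : dfun -> dfun) : Prop :=
  bounded_op H (ip_norm ip) T /\
  exists T' : dfun -> dfun,
    bounded_op H (ip_norm ip) T' /\
    (forall f g, H f -> H g -> ip (T f) g = ip f (T' g)) /\
    (forall f, H f -> T (T' f) = T' (T f)).

Definition comp_op (phi : disk -> disk) (f : dfun) : dfun :=
  fun z => f (phi z).

(** * Disk automorphisms *)

Definition unit_arg (theta : R) : C := (cos theta, sin theta).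

Definition mobius (theta : R) (z0 z : C) : C :=
  (unit_arg theta * ((z0 - z) / (1 - Cconj z0 * z)))%C.

(** Extension of [mobius theta z0] to the Riemann sphere, [None] being the
    point at infinity. *)
Definition mobius_sphere (theta : R) (z0 : C) (p : option C) : option C :=
  match p with
  | Some z =>
      if Ceq_dec (1 - Cconj z0 * z)%C (RtoC 0) then None
      else Some (mobius theta z0 z)
  | None =>
      if Ceq_dec z0 (RtoC 0) then None
      else Some (unit_arg theta / Cconj z0)%C
  end.

Definition in_disk (p : option C) : Prop :=
  match p with Some z => Cmod z < 1 | None => False end.

Definition off_closed_disk (p : option C) : Prop :=
  match p with Some z => 1 < Cmod z | None => True end.

Definition disk_automorphism_of (theta : R) (z0 : C) (phi : disk -> disk)
    : Prop :=
  Cmod z0 < 1 /\ forall z : disk, disk_val (phi z) = mobius theta z0 z.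

(** The identity is excluded: uniqueness of the fixed points is required. *)
Definition elliptic (phi : disk -> disk) : Prop :=
  exists (theta : R) (z0 : C),
    disk_automorphism_of theta z0 phi /\
    (exists! p, in_disk p /\ mobius_sphere theta z0 p = p) /\
    (exists! p, off_closed_disk p /\ mobius_sphere theta z0 p = p).

Definition Cclosure (A : C -> Prop) (l : C) : Prop :=
  forall eps : R, 0 < eps -> exists x : C, A x /\ Cmod (x - l) < eps.

(* Main.v *)
Require Import Defs.
From Stdlib Require Import Lra Lia FunctionalExtensionality Classical.

(** The crux is that composition with [psi z = (alpha - z) / (1 - conj alpha z)]
    is bounded. Up to rotations it is composition with
    [z |-> (z + r) / (1 + r z)], which runs, as [r] grows from 0, along the flow
    of the vector field [(1 - z^2) / (1 - r^2)]. In the weighted norm,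
    [2 Re <(1 - z^2) f', f>] is a sum of terms
    [2 Re (f_(k+1) conj f_k) ((k+1) beta_k^2 - k beta_(k+1)^2)], and polynomial
    growth says exactly that these are dominated by the norm, so Gronwall's
    inequality bounds the composition operator.
    Since [psi] is an involution with [psi (phi z) = phi'(alpha) psi z] and
    [|phi'(alpha)| = 1], the operator [C_phi] is the coefficient multiplier by
    [phi'(alpha)^n] conjugated by [C_psi]: it is diagonal and normal for the inner
    product transported by [C_psi], and its resolvent is the conjugated multiplier
    by [1 / (phi'(alpha)^n - l)]. *)

(** The energy estimate cannot be run directly on an infinite sequence: the truncated form leaves a
    boundary term at the cut [K] that has to be shown to vanish, and the energy has to be
    differentiated term by term. Hence two truncations: polynomials of degree at most [N], whose
    images along the flow have coefficients decaying geometrically, and energies cut at [K]. For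
    fixed [N] the boundary error disappears as [K] grows; the constant that remains does not depend
    on [N], so [N] can tend to infinity afterwards. The matrix of the flow is real, so real and
    imaginary parts of the coefficients evolve separately and with the same constant. When [alpha]
    is not 0, [C_phi] is in general not normal for the given inner product; normality refers to an
    equivalent one. For [alpha = 0] the involution is negation and the transported inner product is
    the original one. The spectrum does not see the change of norm. *)

Ltac real_eq := match goal with |- ?x = ?y => change (@eq R x y) end.

(** The function [exp (- (A t)) (g t + e / A)] is nonincreasing: the shift by [e / A] absorbs the
    constant error into a homogeneous inequality. The error is kept because a truncated energy obeys
    its growth inequality only up to a boundary term. *)
Lemma gronwall (g dg : R -> R) (T A e : R) :
  0 <= T -> 0 < A -> 0 <= e ->
  (forall t, 0 <= t <= T -> is_derive g t (dg t)) ->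
  (forall t, 0 <= t <= T -> dg t <= A * g t + e) ->
  g T <= exp (A * T) * (g 0 + e / A).
Proof.
  intros HT HA He0 Hd Hb.
  set (h := fun t => exp (- (A * t)) * (g t + e / A)).
  assert (Hh : forall t, 0 <= t <= T ->
      is_derive h t (exp (- (A * t)) * (dg t - A * g t - e))).
  { intros t Ht. unfold h.
    assert (Hg := Hd t Ht).
    auto_derive. { exists (dg t); exact Hg. }
    replace (Derive _ t) with (dg t)
      by (symmetry; apply is_derive_unique; exact Hg).
    field. lra. }
  assert (Hle : h T <= h 0).
  { destruct (MVT_gen h 0 T (fun t => exp (- (A * t)) * (dg t - A * g t - e)))
      as [c [Hc Heq]].
    - intros x Hx. rewrite Rmin_left, Rmax_right in Hx by lra. apply Hh; lra.
    - intros x Hx. rewrite Rmin_left, Rmax_right in Hx by lra.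
      apply continuity_pt_filterlim.
      apply (ex_derive_continuous h x). eexists. apply Hh; lra.
    - rewrite Rmin_left, Rmax_right in Hc by lra.
      assert (Hbc := Hb c Hc). assert (He := exp_pos (- (A * c))).
      assert (exp (- (A * c)) * (dg c - A * g c - e) * (T - 0) <= 0); [|lra].
      assert (exp (- (A * c)) * (dg c - A * g c - e) <= 0) by nra. nra. }
  unfold h in Hle. rewrite Rmult_0_r, Ropp_0, exp_0, exp_Ropp in Hle.
  assert (He := exp_pos (A * T)).
  assert (0 <= e / A) by (apply Rdiv_le_0_compat; lra).
  apply Rmult_le_compat_l with (r := exp (A * T)) in Hle; [|lra].
  rewrite <- Rmult_assoc, Rinv_r, Rmult_1_l in Hle by lra. lra.
Qed.

Lemma is_derive_id_mult (f : R -> R) (x df : R) :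
  is_derive f x df -> is_derive (fun t => t * f t) x (f x + x * df).
Proof.
  intros Hf. auto_derive. { exists df; exact Hf. }
  replace (Derive _ x) with df
    by (symmetry; apply is_derive_unique; exact Hf).
  ring.
Qed.

(** * The coefficients of the powers of a disk automorphism *)

(** If [b] denotes the result, then [b (1 + r z) = (z + r) a] as power series; comparing
    coefficients of [z^k] gives this recursion, which replaces a division of series. *)
Fixpoint mobius_step (r : R) (a : nat -> R) (k : nat) : R :=
  match k with
  | O => r * a O
  | S j => a j + r * a (S j) - r * mobius_step r a j
  end.

(* [mobius_coef r n] are the Taylor coefficients of
   [z |-> ((z + r) / (1 + r z))^n]. *)
Fixpoint mobius_coef (r : R) (n : nat) : nat -> R :=
  match n with
  | O => fun k => match k with O => 1 | S _ => 0 end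
  | S m => mobius_step r (mobius_coef r m)
  end.

(* Coefficients of [z^2 f'] when [a] are those of [f]. *)
Definition z2deriv (a : nat -> R) (k : nat) : R :=
  match k with O => 0 | S j => INR j * a j end.

(** This is Cauchy's estimate on the circle [|z| = 1 / s], inside the pole at [- 1 / r]: there
    [(z + r) / (1 + r z)] has modulus at most [(1 + r s) / (s - r)], hence at most
    [q = (1 + s) / (s - r0)]. The induction reproves it from the recursion through
    [1 + r s + r q <= q s]. Uniformity in [r <= r0] is what the flow argument needs. *)
Lemma mobius_coef_decay (r0 s r : R) (n k : nat) :
  0 <= r <= r0 -> r0 < s -> s < 1 ->
  Rabs (mobius_coef r n k) <= ((1 + s) / (s - r0)) ^ n * s ^ k.
Proof.
  intros Hr Hs Hs1. revert k.
  set (q := (1 + s) / (s - r0)).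
  assert (Hq : q * (s - r0) = 1 + s) by (unfold q; field; lra).
  assert (Hq1 : 1 <= q) by nra.
  induction n as [|n IH]; intros k.
  - destruct k as [|k]; simpl.
    + rewrite Rabs_R1; lra.
    + rewrite Rabs_R0. assert (0 <= s ^ k) by (apply pow_le; lra). nra.
  - simpl mobius_coef. set (a := mobius_coef r n) in *.
    assert (Hqn : 0 < q ^ n) by (apply pow_lt; lra).
    induction k as [|k IHk]; simpl mobius_step.
    + rewrite Rabs_mult, (Rabs_pos_eq r) by lra.
      specialize (IH 0%nat). simpl in *.
      assert (H := Rabs_pos (a 0%nat)). nra.
    + assert (H1 := IH k). assert (H2 := IH (S k)).
      assert (Hsk : 0 < s ^ k) by (apply pow_lt; lra).
      eapply Rle_trans; [apply Rabs_triang|].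
      eapply Rle_trans; [apply Rplus_le_compat_r; apply Rabs_triang|].
      rewrite Rabs_Ropp, !Rabs_mult, (Rabs_pos_eq r) by lra.
      set (P := q ^ n * s ^ k) in *.
      assert (HP : 0 < P) by (apply Rmult_lt_0_compat; assumption).
      replace (q ^ n * s ^ S k) with (P * s) in H2 by (unfold P; simpl; ring).
      replace (q ^ S n * s ^ k) with (P * q) in IHk by (unfold P; simpl; ring).
      replace (q ^ S n * s ^ S k) with (P * (q * s)) by (unfold P; simpl; ring).
      apply Rle_trans with (P + r * (P * s) + r * (P * q)).
      { apply Rplus_le_compat; [apply Rplus_le_compat; [exact H1|]|];
          apply Rmult_le_compat_l; lra. }
      replace (P + r * (P * s) + r * (P * q)) with (P * (1 + r * s + r * q))
        by ring.
      apply Rmult_le_compat_l; [lra|]. nra.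
Qed.

(* In terms of [F r z = ((z + r) / (1 + r z))^n], the flow equation
   [(1 - r^2) dF/dr = (1 - z^2) dF/dz]. *)
Lemma mobius_coef_derive (n k : nat) (r : R) :
  1 - r ^ 2 <> 0 ->
  is_derive (fun r => mobius_coef r n k) r
    (((INR k + 1) * mobius_coef r n (S k) - z2deriv (mobius_coef r n) k)
       / (1 - r ^ 2)).
Proof.
  intros Hr. revert k. induction n as [|n IH]; intros k.
  - destruct k as [|[|k]]; simpl;
      [ eapply (is_derive_ext (fun _ => 1)); [reflexivity|]
      | eapply (is_derive_ext (fun _ => 0)); [reflexivity|]
      | eapply (is_derive_ext (fun _ => 0)); [reflexivity|] ];
      auto_derive; trivial; field; simpl in Hr; lra.
  - set (a := mobius_coef r n) in *.
    set (b := mobius_step r a).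
    assert (Hstep : forall k db,
      is_derive (fun r => mobius_coef r (S n) k) r db ->
      is_derive (fun r => mobius_coef r (S n) (S k)) r
        (((INR k + 1) * a (S k) - z2deriv a k) / (1 - r ^ 2)
         + (a (S k) + r * (((INR (S k) + 1) * a (S (S k)) - z2deriv a (S k)) / (1 - r ^ 2)))
         - (b k + r * db))).
    { intros j db Hj. simpl mobius_coef. simpl mobius_step.
      assert (H0 := IH j). assert (H1 := IH (S j)).
      fold a in H0, H1.
      apply (is_derive_minus
        (fun r => mobius_coef r n j + r * mobius_coef r n (S j))
        (fun r => r * mobius_coef r (S n) j)).
      - apply (is_derive_plus (fun r => mobius_coef r n j)
                (fun r => r * mobius_coef r n (S j))); [exact H0|].
        exact (is_derive_id_mult _ _ _ H1).
      - exact (is_derive_id_mult _ _ _ Hj). }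
    change (mobius_coef r (S n)) with b.
    (* After every later entry of [b] is unfolded by its recursion, the claim is a rational identity
       in entries of [a] and at most one entry of [b]. The first two indices are separate because
       [z2deriv] and the recursion start differently at 0. *)
    assert (Hb : forall j, b (S j) = a j + r * a (S j) - r * b j)
      by reflexivity.
    assert (Hb0 : b 0%nat = r * a 0%nat) by reflexivity.
    induction k as [|k IHk].
    + evar_last. { simpl mobius_coef. simpl mobius_step.
        exact (is_derive_id_mult _ _ _ (IH 0%nat)). }
      cbv beta. change (mobius_coef r n 0) with (a 0%nat). simpl INR. cbn [z2deriv].
      rewrite Hb, Hb0.
      real_eq. field. simpl in Hr; lra.
    + evar_last. { apply Hstep; exact IHk. }
      destruct k as [|k].
      * cbn [z2deriv]. rewrite !Hb, !Hb0. real_eq. simpl INR. field. simpl in Hr; lra.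
      * cbn [z2deriv]. rewrite !(Hb (S _)), (Hb k), !S_INR. real_eq. field. simpl in Hr; lra.
Qed.

(** * Truncated energies along the flow *)

Lemma sum_n_S (a : nat -> R) (n : nat) : sum_n a (S n) = sum_n a n + a (S n).
Proof. exact (sum_Sn a n). Qed.

Lemma sum_n_0 (a : nat -> R) : sum_n a 0 = a O.
Proof. exact (sum_O a). Qed.

Lemma sum_n_nonneg (a : nat -> R) (n : nat) :
  (forall k, 0 <= a k) -> 0 <= sum_n a n.
Proof.
  intros H; induction n as [|n IH]; [rewrite sum_n_0|rewrite sum_n_S]; auto.
  assert (Hn := H (S n)); lra.
Qed.

Lemma sum_n_mono (a : nat -> R) (n m : nat) :
  (forall k, 0 <= a k) -> (n <= m)%nat -> sum_n a n <= sum_n a m.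
Proof.
  intros H Hnm; induction Hnm as [|m _ IH]; [lra|].
  rewrite sum_n_S. assert (Hn := H (S m)); lra.
Qed.

Lemma sum_n_Rscal (c : R) (a : nat -> R) (n : nat) :
  sum_n (fun k => c * a k) n = c * sum_n a n.
Proof. exact (sum_n_mult_l c a n). Qed.

Lemma commutator_const_nonneg (b : nat -> R) (c : R) :
  (forall k, 0 < b k) ->
  (forall k, Rabs ((INR k + 1) * b k ^ 2 - INR k * b (S k) ^ 2)
             <= c * (b k * b (S k))) ->
  0 <= c.
Proof.
  intros Hb Hc. assert (H := Rle_trans _ _ _ (Rabs_pos _) (Hc O)).
  assert (0 < b O * b 1%nat) by (apply Rmult_lt_0_compat; apply Hb).
  destruct (Rle_dec 0 c); [assumption|nra].
Qed.

(* The form [<(1 - z^2) f', f>] is tridiagonal; symmetrizing it leaves the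
   combination [(k+1) b_k^2 - k b_(k+1)^2], which polynomial growth controls,
   up to a boundary term. *)
Lemma energy_bound (b y : nat -> R) (c : R) (K : nat) :
  (forall k, 0 < b k) ->
  (forall k, Rabs ((INR k + 1) * b k ^ 2 - INR k * b (S k) ^ 2)
             <= c * (b k * b (S k))) ->
  Rabs (sum_n (fun k => b k ^ 2 * y k
                 * ((INR k + 1) * y (S k) - z2deriv y k)) K
        - b K ^ 2 * (INR K + 1) * y K * y (S K))
  <= c * sum_n (fun k => b k ^ 2 * y k ^ 2) K - c / 2 * (b K ^ 2 * y K ^ 2).
Proof.
  intros Hb Hc.
  assert (Hc0 := commutator_const_nonneg b c Hb Hc).
  induction K as [|K IH].
  - rewrite !sum_n_0. simpl INR. cbn [z2deriv].
    match goal with |- Rabs ?e <= _ => replace e with 0 by ring end.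
    rewrite Rabs_R0. assert (0 <= b O ^ 2 * y O ^ 2) by
      (apply Rmult_le_pos; apply pow2_ge_0). nra.
  - rewrite !sum_n_S.
    match type of IH with Rabs ?e <= _ => set (P := e) in * end.
    (* The new summand cancels the new boundary term, leaving its [z2deriv] part; together with the
       old boundary term, which is no longer subtracted, this is [D y_K y_(K+1)]. *)
    set (D := (INR K + 1) * b K ^ 2 - INR K * b (S K) ^ 2).
    match goal with |- Rabs ?e <= _ => replace e with (P + D * (y K * y (S K)))
      by (unfold P, D; rewrite S_INR; cbn [z2deriv]; ring) end.
    eapply Rle_trans; [apply Rabs_triang|].
    (* The arithmetic-geometric mean inequality shares the cross term equally between the indices
       [K] and [K + 1]. The half term subtracted in the statement is the share that the last index
       has yet to receive from its right neighbour. *)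
    assert (HD : Rabs (D * (y K * y (S K)))
       <= c / 2 * (b K ^ 2 * y K ^ 2 + b (S K) ^ 2 * y (S K) ^ 2)).
    { rewrite !Rabs_mult.
      set (u := Rabs (y K)). set (v := Rabs (y (S K))).
      replace (y K ^ 2) with (u ^ 2) by apply pow2_abs.
      replace (y (S K) ^ 2) with (v ^ 2) by apply pow2_abs.
      assert (Hu : 0 <= u * v) by (apply Rmult_le_pos; apply Rabs_pos).
      apply Rle_trans with (c * (b K * b (S K)) * (u * v)).
      - apply Rmult_le_compat_r; [assumption|apply Hc].
      - assert (H := pow2_ge_0 (b K * u - b (S K) * v)). nra. }
    lra.
Qed.

(** Coefficients of [p ((z + r) / (1 + r z))] for the polynomial [p] of degree at most [N] with
    coefficients [x]. Finiteness of the sum allows differentiation in [r] term by term. *)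
Definition mobius_apply (r : R) (N : nat) (x : nat -> R) (k : nat) : R :=
  sum_n (fun n => mobius_coef r n k * x n) N.

Lemma z2deriv_sum (a : nat -> nat -> R) (x : nat -> R) (N k : nat) :
  z2deriv (fun k => sum_n (fun n => a n k * x n) N) k
  = sum_n (fun n => z2deriv (a n) k * x n) N.
Proof.
  destruct k as [|k]; cbn [z2deriv].
  - symmetry. rewrite (sum_n_ext _ (fun n => 0 * 0)) by (intros; real_eq; ring).
    rewrite sum_n_Rscal; ring.
  - rewrite <- sum_n_Rscal. apply sum_n_ext; intros; real_eq; ring.
Qed.

Lemma is_derive_mult_const (f : R -> R) (x df c : R) :
  is_derive f x df -> is_derive (fun t => f t * c) x (df * c).
Proof.
  intros Hf. auto_derive. { exists df; exact Hf. }
  replace (Derive _ x) with df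
    by (symmetry; apply is_derive_unique; exact Hf).
  ring.
Qed.

Lemma is_derive_scal_sqr (f : R -> R) (x df c : R) :
  is_derive f x df -> is_derive (fun t => c * f t ^ 2) x (c * (2 * f x * df)).
Proof.
  intros Hf. auto_derive. { exists df; exact Hf. }
  replace (Derive _ x) with df
    by (symmetry; apply is_derive_unique; exact Hf).
  ring.
Qed.

Lemma mobius_apply_derive (N : nat) (x : nat -> R) (k : nat) (r : R) :
  1 - r ^ 2 <> 0 ->
  is_derive (fun r => mobius_apply r N x k) r
    (((INR k + 1) * mobius_apply r N x (S k) - z2deriv (mobius_apply r N x) k)
       / (1 - r ^ 2)).
Proof.
  intros Hr. unfold mobius_apply.
  rewrite z2deriv_sum, <- sum_n_Rscal.
  evar_last.
  - apply (is_derive_sum_n (fun n r => mobius_coef r n k * x n) N r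
      (fun n => ((INR k + 1) * mobius_coef r n (S k)
                 - z2deriv (mobius_coef r n) k) / (1 - r ^ 2) * x n)).
    intros n _. apply is_derive_mult_const. apply mobius_coef_derive; exact Hr.
  - unfold Rdiv. rewrite (Rmult_comm _ (/ _)).
    replace (sum_n _ N - sum_n _ N) with
      (sum_n (fun n => (INR k + 1) * (mobius_coef r n (S k) * x n)
               + (-1) * (z2deriv (mobius_coef r n) k * x n)) N).
    + rewrite <- sum_n_Rscal. apply sum_n_ext; intros n.
      real_eq. field. simpl in Hr; lra.
    + etransitivity; [apply (sum_n_plus (G := R_AbelianMonoid))|].
      rewrite (sum_n_Rscal (-1)). unfold plus; simpl. ring.
Qed.

(** The constant depends on [N] and [x]. This is harmless: the estimate serves only to make the
    boundary term vanish and leaves no trace in the final bound. *)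
Lemma mobius_apply_decay (r0 s r : R) (N : nat) (x : nat -> R) (k : nat) :
  0 <= r <= r0 -> r0 < s -> s < 1 ->
  Rabs (mobius_apply r N x k)
  <= sum_n (fun n => ((1 + s) / (s - r0)) ^ n * Rabs (x n)) N * s ^ k.
Proof.
  intros Hr Hs Hs1. unfold mobius_apply.
  assert (H : forall n, Rabs (mobius_coef r n k * x n)
     <= ((1 + s) / (s - r0)) ^ n * Rabs (x n) * s ^ k).
  { intros n. rewrite Rabs_mult.
    assert (H := mobius_coef_decay r0 s r n k Hr Hs Hs1).
    assert (H' := Rabs_pos (x n)). nra. }
  induction N as [|N IH].
  - rewrite !sum_n_0. apply H.
  - rewrite !sum_n_S. eapply Rle_trans; [apply Rabs_triang|].
    assert (HN := H (S N)). lra.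
Qed.

Lemma mobius_coef_0 (n k : nat) :
  mobius_coef 0 n k = if Nat.eqb n k then 1 else 0.
Proof.
  revert k; induction n as [|n IH]; intros [|k]; try reflexivity.
  - simpl. ring.
  - simpl Nat.eqb. rewrite <- IH. simpl. ring.
Qed.

Lemma mobius_apply_0 (N : nat) (x : nat -> R) (k : nat) :
  mobius_apply 0 N x k = if Nat.leb k N then x k else 0.
Proof.
  unfold mobius_apply. induction N as [|N IH].
  - rewrite sum_n_0, mobius_coef_0. destruct k; simpl; ring.
  - rewrite sum_n_S, IH, mobius_coef_0.
    destruct (Nat.leb_spec k N), (Nat.leb_spec k (S N)), (Nat.eqb_spec (S N) k);
      try lia; subst; ring.
Qed.

Lemma sum_n_truncate (c : nat -> R) (N K : nat) :
  (forall k, 0 <= c k) ->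
  sum_n (fun k => if Nat.leb k N then c k else 0) K <= sum_n c N.
Proof.
  intros Hc.
  assert (H : sum_n (fun k => if Nat.leb k N then c k else 0) K
              = sum_n c (Nat.min K N)).
  { induction K as [|K IH].
    - rewrite !sum_n_0. reflexivity.
    - rewrite sum_n_S, IH. destruct (Nat.leb_spec (S K) N).
      + rewrite !Nat.min_l by lia. rewrite sum_n_S. reflexivity.
      + rewrite !Nat.min_r by lia. real_eq; ring. }
  rewrite H. apply sum_n_mono; [assumption|lia].
Qed.

(** * Boundedness of the coefficient matrix on weighted sequences *)

(** Gronwall's inequality runs from [r = 0], where the matrix is the identity, to [r0], on the
    energy cut at [K]. The constant [exp (A r0)] involves only [c] and [r0], so it survives both
    limits. *)
Lemma mobius_apply_bounded (b : nat -> R) (c r0 : R) :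
  (forall k, 0 < b k) ->
  (forall k, Rabs ((INR k + 1) * b k ^ 2 - INR k * b (S k) ^ 2)
             <= c * (b k * b (S k))) ->
  (forall s, 0 < s < 1 ->
     is_lim_seq (fun k => b k ^ 2 * (INR k + 1) * (s ^ 2) ^ k) 0) ->
  0 <= r0 < 1 ->
  exists B, 0 < B /\ forall N x K,
    sum_n (fun k => b k ^ 2 * mobius_apply r0 N x k ^ 2) K
    <= B * sum_n (fun n => b n ^ 2 * x n ^ 2) N.
Proof.
  intros Hb Hc Hlim Hr0.
  set (s := (1 + r0) / 2).
  assert (Hs : r0 < s < 1) by (unfold s; lra).
  assert (Hc0 := commutator_const_nonneg b c Hb Hc).
  set (w := 1 - r0 ^ 2).
  assert (Hw : 0 < w) by (unfold w; nra).
  (* The energy has derivative [2 / (1 - t^2)] times the form bounded by [energy_bound], and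
     [1 - t^2 >= w] on the interval. Taking [c + 1] instead of [c] ensures [0 < A]. *)
  set (A := 2 * (c + 1) / w).
  assert (HA : 0 < A) by (unfold A; apply Rdiv_lt_0_compat; lra).
  exists (exp (A * r0)). split; [apply exp_pos|]. intros N x K0.
  set (Q := sum_n (fun n => ((1 + s) / (s - r0)) ^ n * Rabs (x n)) N).
  assert (HQ : 0 <= Q).
  { apply sum_n_nonneg. intros n. apply Rmult_le_pos; [|apply Rabs_pos].
    apply pow_le. apply Rdiv_le_0_compat; lra. }
  (* The boundary term of [energy_bound], times [2 / w], with the geometric decay inserted at both
     [K] and [K + 1]. The resulting power [s^(2K+1)] makes it tend to 0 by the third hypothesis. *)
  set (e := fun K => 2 * (b K ^ 2 * (INR K + 1) * (Q * s ^ K) * (Q * s ^ S K)) / w).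
  set (g := fun K r => sum_n (fun k => b k ^ 2 * mobius_apply r N x k ^ 2) K).
  set (X := sum_n (fun n => b n ^ 2 * x n ^ 2) N).
  assert (HE : forall K, 0 <= e K).
  { intros K. unfold e. apply Rdiv_le_0_compat; [|lra].
    assert (0 <= s ^ K) by (apply pow_le; lra).
    assert (0 <= s ^ S K) by (apply pow_le; lra).
    assert (0 <= INR K) by apply pos_INR.
    assert (0 <= b K ^ 2) by apply pow2_ge_0.
    repeat (apply Rmult_le_pos; try lra). }
  assert (Hg : forall K, g K r0 <= exp (A * r0) * (X + e K / A)).
  { intros K.
    apply Rle_trans with (exp (A * r0) * (g K 0 + e K / A)).
    - apply gronwall with (dg := fun r => 2 / (1 - r ^ 2) *
        sum_n (fun k => b k ^ 2 * mobius_apply r N x k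
          * ((INR k + 1) * mobius_apply r N x (S k)
             - z2deriv (mobius_apply r N x) k)) K); try lra; auto.
      + intros t Ht.
        assert (Ht2 : 1 - t ^ 2 <> 0) by nra.
        rewrite <- sum_n_Rscal. unfold g.
        apply (is_derive_sum_n (fun k r => b k ^ 2 * mobius_apply r N x k ^ 2)).
        intros k _.
        assert (Hd := mobius_apply_derive N x k t Ht2).
        evar_last. { exact (is_derive_scal_sqr _ _ _ (b k ^ 2) Hd). }
        real_eq. cbv beta. field. simpl in Ht2; lra.
      + intros t Ht. cbv beta.
        assert (HEn := energy_bound b (mobius_apply t N x) c K Hb Hc).
        fold (g K t) in HEn.
        match type of HEn with Rabs (?S - ?T) <= _ =>
          set (Sm := S) in *; set (Tm := T) in * end.
        assert (HT : Tm <= b K ^ 2 * (INR K + 1) * (Q * s ^ K) * (Q * s ^ S K)).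
        { eapply Rle_trans; [apply Rle_abs|]. unfold Tm.
          assert (0 <= b K ^ 2 * (INR K + 1)).
          { apply Rmult_le_pos; [apply pow2_ge_0|].
            assert (H := pos_INR K); lra. }
          rewrite 2!Rabs_mult, (Rabs_pos_eq (b K ^ 2 * _)) by assumption.
          rewrite !Rmult_assoc. rewrite <- !(Rmult_assoc (b K ^ 2)).
          apply Rmult_le_compat_l; [assumption|].
          rewrite <- Rmult_assoc.
          replace (Q * (s ^ K * (Q * s ^ S K))) with ((Q * s ^ K) * (Q * s ^ S K)) by ring.
          apply Rmult_le_compat; try apply Rabs_pos;
            apply mobius_apply_decay; lra. }
        assert (HS : Sm <= c * g K t + b K ^ 2 * (INR K + 1) * (Q * s ^ K) * (Q * s ^ S K)).
        { assert (H := Rle_abs (Sm - Tm)).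
          assert (0 <= c / 2 * (b K ^ 2 * mobius_apply t N x K ^ 2)).
          { apply Rmult_le_pos; [lra|]. apply Rmult_le_pos; apply pow2_ge_0. }
          change (sum_n _ K) with (g K t) in HEn. lra. }
        assert (Hgt : 0 <= g K t).
        { apply sum_n_nonneg; intros; apply Rmult_le_pos; apply pow2_ge_0. }
        assert (Hwt : w <= 1 - t ^ 2) by (unfold w; nra).
        set (U := b K ^ 2 * (INR K + 1) * (Q * s ^ K) * (Q * s ^ S K)) in *.
        assert (HU : 0 <= U).
        { assert (H := HE K). unfold e in H. fold U in H.
          apply Rmult_le_compat_r with (r := w) in H; [|lra].
          unfold Rdiv in H. rewrite Rmult_assoc, Rinv_l in H by lra. lra. }
        unfold A, e. fold U.
        apply Rle_trans with (2 / (1 - t ^ 2) * ((c + 1) * g K t + U)).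
        { apply Rmult_le_compat_l; [apply Rdiv_le_0_compat; lra|]. lra. }
        replace (2 * (c + 1) / w * g K t + 2 * U / w)
          with (2 / w * ((c + 1) * g K t + U)) by (field; lra).
        apply Rmult_le_compat_r; [nra|].
        apply Rmult_le_compat_l; [lra|]. apply Rinv_le_contravar; lra.
    - apply Rmult_le_compat_l; [left; apply exp_pos|].
      apply Rplus_le_compat_r. unfold g, X.
      rewrite (sum_n_ext _ (fun k => if Nat.leb k N then b k ^ 2 * x k ^ 2 else 0)).
      + apply sum_n_truncate. intros; apply Rmult_le_pos; apply pow2_ge_0.
      + intros k. rewrite mobius_apply_0. destruct (Nat.leb k N); real_eq; ring. }
  assert (He : is_lim_seq e 0).
  { apply is_lim_seq_ext with
      (fun K => (2 * Q ^ 2 * s / w) * (b K ^ 2 * (INR K + 1) * (s ^ 2) ^ K)).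
    - intros K. unfold e. rewrite <- pow_mult, Nat.mul_comm, pow_mult. simpl. field. lra.
    - replace (Finite 0) with (Rbar_mult (2 * Q ^ 2 * s / w) 0)
        by (simpl; f_equal; ring).
      apply is_lim_seq_scal_l. apply Hlim. lra. }
  assert (Hl : is_lim_seq (fun K => exp (A * r0) * (X + e K / A))
                 (exp (A * r0) * X + exp (A * r0) / A * 0)).
  { apply is_lim_seq_ext with (fun K => exp (A * r0) * X + exp (A * r0) / A * e K).
    - intros; field; lra.
    - apply (is_lim_seq_plus' _ _ (exp (A * r0) * X) (exp (A * r0) / A * 0));
        [apply is_lim_seq_const|].
      exact (is_lim_seq_scal_l _ (exp (A * r0) / A) 0 He). }
  (* The error is attached to the cut, so the requested cut [K0] is kept on the left, its energy is
     bounded by the one cut at a larger [K], and only [K] tends to infinity. *)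
  assert (Hle : Rbar_le (g K0 r0) (exp (A * r0) * X + exp (A * r0) / A * 0));
    [|simpl in Hle; rewrite Rmult_0_r, Rplus_0_r in Hle; exact Hle].
  apply (is_lim_seq_le_loc (fun _ => g K0 r0) _ (g K0 r0) _) with (3 := Hl).
  - exists K0. intros K HK. eapply Rle_trans; [|apply Hg].
    apply sum_n_mono; [|assumption].
    intros; apply Rmult_le_pos; apply pow2_ge_0.
  - apply is_lim_seq_const.
Qed.

(** * Weights of polynomial growth *)

Lemma beta_pos (w : nat -> R) (k : nat) : is_weight w -> 0 < beta w k.
Proof.
  intros [Hw _]. induction k as [|k IH]; simpl; [lra|].
  apply Rmult_lt_0_compat; [exact IH|apply Hw; lia].
Qed.

(** The limit 1 leaves finitely many weights to minimize over. The bound gives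
    [m beta_k <= beta_(k+1)], which allows an estimate in [beta_k^2] to be restated in the symmetric
    form [beta_k beta_(k+1)]. *)
Lemma weight_lower_bound (w : nat -> R) :
  is_weight w -> exists m, 0 < m /\ forall k, (1 <= k)%nat -> m <= w k.
Proof.
  intros [Hw Hlim].
  apply is_lim_seq_spec in Hlim.
  destruct (Hlim (mkposreal (1 / 2) ltac:(lra))) as [N HN]. simpl in HN.
  assert (HF : forall n, exists m, 0 < m /\ forall k, (1 <= k <= n)%nat -> m <= w k).
  { induction n as [|n [m [Hm IH]]].
    - exists 1. split; [lra|lia].
    - exists (Rmin m (w (S n))). split.
      + apply Rmin_glb_lt; [exact Hm|apply Hw; lia].
      + intros k Hk. destruct (Nat.eq_dec k (S n)) as [->|Hne].
        * apply Rmin_r.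
        * eapply Rle_trans; [apply Rmin_l|apply IH; lia]. }
  destruct (HF N) as [m [Hm HmN]].
  exists (Rmin m (1 / 2)). split; [apply Rmin_glb_lt; lra|].
  intros k Hk. destruct (Nat.le_gt_cases k N) as [HkN|HkN].
  - eapply Rle_trans; [apply Rmin_l|apply HmN; lia].
  - eapply Rle_trans; [apply Rmin_r|].
    assert (H := HN k ltac:(lia)). apply Rabs_def2 in H. lra.
Qed.

(** With [v = w_(k+1)] the expression factors as [beta_k^2 (1 + k (1 - v) (1 + v))]. Polynomial
    growth bounds [k |1 - v|] by [M] and [1 + v] by [2 + M]; dividing by the lower bound [m] of the
    weights trades [beta_k^2] for [beta_k beta_(k+1)]. *)
Lemma weight_commutator (w : nat -> R) :
  is_weight w -> polynomial_growth w ->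
  exists c, forall k,
    Rabs ((INR k + 1) * beta w k ^ 2 - INR k * beta w (S k) ^ 2)
    <= c * (beta w k * beta w (S k)).
Proof.
  intros Hw [M HM].
  destruct (weight_lower_bound w Hw) as [m [Hm Hmw]].
  exists ((1 + M * (2 + M)) / m). intros k.
  assert (Hb := beta_pos w k Hw).
  assert (Hmk := Hmw (S k) ltac:(lia)). assert (HMk := HM (S k) ltac:(lia)).
  simpl beta. set (b := beta w k) in *. set (v := w (S k)) in *.
  rewrite S_INR in HMk. assert (Hk := pos_INR k). set (n := INR k) in *.
  replace ((n + 1) * b ^ 2 - n * (b * v) ^ 2)
    with (b ^ 2 * (1 + n * (1 - v) * (1 + v))) by ring.
  rewrite Rabs_mult, (Rabs_pos_eq (b ^ 2)) by apply pow2_ge_0.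
  assert (Ha : Rabs (1 + n * (1 - v) * (1 + v)) <= 1 + M * (2 + M)).
  { assert (Hn1 : Rabs (n * (1 - v)) <= M).
    { rewrite Rabs_mult, (Rabs_pos_eq n), Rabs_minus_sym by assumption.
      assert (H := Rabs_pos (v - 1)). nra. }
    assert (Hv : Rabs (1 + v) <= 2 + M).
    { replace (1 + v) with (2 + (v - 1)) by ring.
      eapply Rle_trans; [apply Rabs_triang|]. rewrite (Rabs_pos_eq 2) by lra.
      assert (H := Rabs_pos (v - 1)). nra. }
    eapply Rle_trans; [apply Rabs_triang|]. rewrite Rabs_R1.
    apply Rplus_le_compat_l. rewrite Rabs_mult.
    apply Rmult_le_compat; try apply Rabs_pos; assumption. }
  assert (HM0 : 0 <= 1 + M * (2 + M)).
  { eapply Rle_trans; [apply Rabs_pos|exact Ha]. }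
  apply Rle_trans with (b ^ 2 * (1 + M * (2 + M))).
  - apply Rmult_le_compat_l; [apply pow2_ge_0|exact Ha].
  - replace ((1 + M * (2 + M)) / m * (b * (b * v)))
      with (b ^ 2 * (1 + M * (2 + M)) * (v / m)) by (field; lra).
    rewrite <- (Rmult_1_r (b ^ 2 * (1 + M * (2 + M)))) at 1.
    apply Rmult_le_compat_l.
    + apply Rmult_le_pos; [apply pow2_ge_0|exact HM0].
    + apply Rmult_le_reg_r with m; [exact Hm|].
      unfold Rdiv. rewrite Rmult_assoc, Rinv_l by lra. lra.
Qed.

(** The weights tend to 1, so consecutive terms have ratio tending to [s^2 < 1]; the ratio test even
    gives a convergent series. *)
Lemma beta_geom_lim (w : nat -> R) (s : R) :
  is_weight w -> 0 < s < 1 ->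
  is_lim_seq (fun k => beta w k ^ 2 * (INR k + 1) * (s ^ 2) ^ k) 0.
Proof.
  intros Hw Hs.
  assert (Hpos : forall k, 0 < beta w k ^ 2 * (INR k + 1) * (s ^ 2) ^ k).
  { intros k. assert (H := pos_INR k).
    apply Rmult_lt_0_compat; [apply Rmult_lt_0_compat; [|lra]|].
    - apply pow_lt, beta_pos, Hw.
    - apply pow_lt, pow_lt; lra. }
  apply ex_series_lim_0.
  eapply ex_series_ext; [|apply (ex_series_DAlembert
    (fun k => beta w k ^ 2 * (INR k + 1) * (s ^ 2) ^ k) (s ^ 2))].
  - intros k. apply Rabs_pos_eq, Rlt_le, Hpos.
  - nra.
  - intros k. apply Rgt_not_eq, Hpos.
  - assert (Hl : is_lim_seq (fun k => w (S k) * w (S k) * (1 + / (INR k + 1)) * s ^ 2)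
        (1 * 1 * (1 + 0) * s ^ 2)).
    { destruct Hw as [_ Hlim]. apply is_lim_seq_incr_1 in Hlim.
      apply is_lim_seq_mult'; [|apply is_lim_seq_const].
      apply is_lim_seq_mult'.
      - apply is_lim_seq_mult'; exact Hlim.
      - apply is_lim_seq_plus'; [apply is_lim_seq_const|].
        replace (Finite 0) with (Rbar_inv p_infty) by reflexivity.
        apply is_lim_seq_inv; [|discriminate].
        apply is_lim_seq_ext with (fun k => INR (S k)); [intros; apply S_INR|].
        apply -> is_lim_seq_incr_1. apply is_lim_seq_INR. }
    replace (s ^ 2) with (1 * 1 * (1 + 0) * s ^ 2) at 1 by ring.
    eapply is_lim_seq_ext; [|exact Hl]. intros k. cbv beta.
    assert (Hk := pos_INR k). assert (Hb := beta_pos w k Hw).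
    rewrite Rabs_pos_eq.
    2:{ apply Rlt_le, Rdiv_lt_0_compat; apply Hpos. }
    rewrite S_INR. cbn [beta]. rewrite <- (tech_pow_Rmult (s ^ 2) k).
    assert (0 < (s ^ 2) ^ k) by (apply pow_lt, pow_lt; lra).
    field. repeat split; lra.
Qed.

(** Finite energy gives [|c_k| <= C / beta_k], so this series dominates the Taylor series at every
    point of modulus [rho]. The case [rho = 0] is separate because the ratio test requires nonzero
    terms. *)
Lemma ex_series_geom_beta (w : nat -> R) (rho : R) :
  is_weight w -> 0 <= rho < 1 -> ex_series (fun k => rho ^ k / beta w k).
Proof.
  intros Hw [[Hr|<-] Hr1].
  - assert (Hpos : forall k, 0 < rho ^ k / beta w k).
    { intros k. apply Rdiv_lt_0_compat; [apply pow_lt; lra|apply beta_pos, Hw]. }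
    eapply ex_series_ext; [|apply (ex_series_DAlembert
      (fun k => rho ^ k / beta w k) rho)].
    + intros k. apply Rabs_pos_eq, Rlt_le, Hpos.
    + exact Hr1.
    + intros k. apply Rgt_not_eq, Hpos.
    + destruct (Hw) as [Hw0 Hlim].
      assert (Hl : is_lim_seq (fun k => rho * / w (S k)) (rho * / 1)).
      { apply is_lim_seq_incr_1 in Hlim.
        apply (is_lim_seq_scal_l (fun k => / w (S k)) rho (/ 1)).
        apply (is_lim_seq_inv _ 1); [exact Hlim|]. intros H; inversion H; lra. }
      replace rho with (rho * / 1) at 1 by field.
      eapply is_lim_seq_ext; [|exact Hl]. intros k. cbv beta.
      rewrite Rabs_pos_eq by (apply Rlt_le, Rdiv_lt_0_compat; apply Hpos).
      simpl. field. assert (H := beta_pos w k Hw). assert (H' := Hw0 (S k) ltac:(lia)).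
      assert (0 < rho ^ k) by (apply pow_lt; lra). repeat split; lra.
  - apply ex_series_incr_1. exists 0.
    apply (is_series_ext (fun _ => 0)); [intros k; simpl; unfold Rdiv; ring|].
    change (is_lim_seq (sum_n (fun _ => 0)) 0).
    apply (is_lim_seq_ext (fun _ => 0)); [|apply is_lim_seq_const].
    intros n. rewrite sum_n_const. ring.
Qed.

(** * Infinite sequences *)

Lemma ex_series_bounded (a : nat -> R) (M : R) :
  (forall k, 0 <= a k) -> (forall n, sum_n a n <= M) -> ex_series a.
Proof.
  intros Ha HM.
  apply (ex_finite_lim_seq_incr (sum_n a) M); [|exact HM].
  intros n. rewrite sum_n_S. assert (H := Ha (S n)); lra.
Qed.

Lemma sum_n_le_Series (a : nat -> R) (n : nat) :
  (forall k, 0 <= a k) -> ex_series a -> sum_n a n <= Series a.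
Proof.
  intros Ha Hs.
  assert (Hl : is_lim_seq (sum_n a) (Series a)) by exact (Series_correct a Hs).
  apply (is_lim_seq_incr_compare _ _ Hl).
  intros m. rewrite sum_n_S. assert (H := Ha (S m)); lra.
Qed.

Lemma le_sum_n (a : nat -> R) (n : nat) :
  (forall k, 0 <= a k) -> a n <= sum_n a n.
Proof.
  intros Ha. destruct n as [|n]; [rewrite sum_n_0; lra|]. rewrite sum_n_S.
  assert (H := sum_n_nonneg a n Ha). lra.
Qed.

Lemma is_lim_seq_sum_n (u : nat -> nat -> R) (l : nat -> R) (K : nat) :
  (forall k, is_lim_seq (fun N => u N k) (l k)) ->
  is_lim_seq (fun N => sum_n (u N) K) (sum_n l K).
Proof.
  intros H. induction K as [|K IH].
  - apply is_lim_seq_ext with (fun N => u N O); [intros; symmetry; apply sum_n_0|].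
    rewrite sum_n_0. apply H.
  - apply is_lim_seq_ext with (fun N => sum_n (u N) K + u N (S K));
      [intros; symmetry; apply sum_n_S|].
    rewrite sum_n_S. apply is_lim_seq_plus'; [exact IH|apply H].
Qed.

Definition drop_first (N : nat) (a : nat -> R) (n : nat) : R :=
  if Nat.leb n N then 0 else a n.

Lemma is_series_drop_first (a : nat -> R) (l : R) (N : nat) :
  is_series a l -> is_series (drop_first N a) (l - sum_n a N).
Proof.
  intros H.
  assert (Hz : sum_n (drop_first N a) N = 0).
  { rewrite (sum_n_ext_loc _ (fun n => 0 * 0)).
    - rewrite sum_n_Rscal; real_eq; ring.
    - intros n Hn. unfold drop_first.
      destruct (Nat.leb_spec n N); [real_eq; ring|lia]. }
  change (is_lim_seq (sum_n (drop_first N a)) (l - sum_n a N)).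
  apply (is_lim_seq_ext_loc (fun n => sum_n a n - sum_n a N)).
  - exists N. intros n Hn. induction Hn as [|n Hn IH].
    + rewrite Hz; ring.
    + rewrite !sum_n_S, <- IH. unfold drop_first at 1.
      destruct (Nat.leb_spec (S n) N); [lia|ring].
  - apply is_lim_seq_minus'; [exact H|apply is_lim_seq_const].
Qed.

(** The limit of [mobius_apply] as [N] grows. [Series] is total, so the definition carries
    information only once [mobius_row_convergent] is available. *)
Definition mobius_limit (r : R) (x : nat -> R) (k : nat) : R :=
  Series (fun n => mobius_coef r n k * x n).

Section InfiniteSequences.

Context {b : nat -> R} {r B : R}.
Hypothesis b_pos : forall k, 0 < b k.
Hypothesis B_pos : 0 < B.
Hypothesis apply_bound : forall N x K,
  sum_n (fun k => b k ^ 2 * mobius_apply r N x k ^ 2) K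
  <= B * sum_n (fun n => b n ^ 2 * x n ^ 2) N.

Let entry_bound N x k :
  b k ^ 2 * mobius_apply r N x k ^ 2
  <= B * sum_n (fun n => b n ^ 2 * x n ^ 2) N.
Proof.
  eapply Rle_trans; [|apply (apply_bound N x k)].
  set (f := fun k => b k ^ 2 * mobius_apply r N x k ^ 2).
  change (f k <= sum_n f k). apply le_sum_n.
  intros; apply Rmult_le_pos; apply pow2_ge_0.
Qed.

(* Testing the bound on the row itself shows that each row of the matrix is
   in the dual weighted space. *)
Lemma mobius_row_summable (k : nat) :
  ex_series (fun n => mobius_coef r n k ^ 2 / b n ^ 2).
Proof.
  assert (Hb2 : forall n, 0 < b n ^ 2) by (intros; apply pow_lt, b_pos).
  apply (ex_series_bounded _ (B / b k ^ 2)).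
  - intros n. apply Rdiv_le_0_compat; [apply pow2_ge_0|apply Hb2].
  - intros N.
    set (S := sum_n (fun n => mobius_coef r n k ^ 2 / b n ^ 2) N).
    (* For this test vector both the matrix entry and the energy equal [S], so the bound reads
       [b_k^2 S^2 <= B S]. *)
    assert (H := entry_bound N (fun n => mobius_coef r n k / b n ^ 2) k).
    replace (mobius_apply r N _ k) with S in H.
    2:{ apply sum_n_ext; intros n. real_eq. field. apply Rgt_not_eq, b_pos. }
    rewrite (sum_n_ext _ (fun n => mobius_coef r n k ^ 2 / b n ^ 2)) in H.
    2:{ intros n. real_eq. field. apply Rgt_not_eq, b_pos. }
    fold S in H.
    assert (HS : 0 <= S).
    { apply sum_n_nonneg; intros n.
      apply Rdiv_le_0_compat; [apply pow2_ge_0|apply Hb2]. }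
    apply Rmult_le_reg_l with (b k ^ 2); [apply Hb2|].
    replace (b k ^ 2 * (B / b k ^ 2)) with B by (field; apply Rgt_not_eq, b_pos).
    destruct HS as [HS|HS]; [|rewrite <- HS; lra].
    apply Rmult_le_reg_r with S; [exact HS|]. lra.
Qed.

Context {x : nat -> R}.
Hypothesis x_l2 : ex_series (fun n => b n ^ 2 * x n ^ 2).

(** The row lies in the dual weighted space and [x] in the space itself; [|u v| <= (u^2 + v^2) / 2]
    takes the place of the Cauchy-Schwarz inequality. *)
Lemma mobius_row_convergent (k : nat) :
  ex_series (fun n => mobius_coef r n k * x n).
Proof.
  apply (ex_series_le (K := R_AbsRing) (V := R_CompleteNormedModule) _
    (fun n => / 2 * (mobius_coef r n k ^ 2 / b n ^ 2 + b n ^ 2 * x n ^ 2))).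
  - intros n. change (norm ?u) with (Rabs u).
    assert (Hb := b_pos n).
    set (u := mobius_coef r n k / b n). set (v := b n * x n).
    replace (mobius_coef r n k * x n) with (u * v) by (unfold u, v; field; lra).
    replace (mobius_coef r n k ^ 2 / b n ^ 2 + b n ^ 2 * x n ^ 2)
      with (u ^ 2 + v ^ 2) by (unfold u, v; field; lra).
    apply Rabs_le. assert (H1 := pow2_ge_0 (u - v)).
    assert (H2 := pow2_ge_0 (u + v)). lra.
  - apply (ex_series_scal_l (V := R_NormedModule)).
    apply (ex_series_plus (V := R_NormedModule));
      [apply mobius_row_summable|exact x_l2].
Qed.

(** A Fatou argument: with [K] fixed the left side is a finite sum, which passes to the limit in [N]
    entry by entry, while the right side is already bounded uniformly in [N]. *)
Lemma mobius_limit_bounded (K : nat) :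
  sum_n (fun k => b k ^ 2 * mobius_limit r x k ^ 2) K
  <= B * Series (fun n => b n ^ 2 * x n ^ 2).
Proof.
  assert (Hle : Rbar_le (sum_n (fun k => b k ^ 2 * mobius_limit r x k ^ 2) K)
    (B * Series (fun n => b n ^ 2 * x n ^ 2))); [|exact Hle].
  apply (is_lim_seq_le
    (fun N => sum_n (fun k => b k ^ 2 * mobius_apply r N x k ^ 2) K)
    (fun _ => B * Series (fun n => b n ^ 2 * x n ^ 2))).
  - intros N. eapply Rle_trans; [apply apply_bound|].
    apply Rmult_le_compat_l; [lra|]. apply sum_n_le_Series; [|exact x_l2].
    intros; apply Rmult_le_pos; apply pow2_ge_0.
  - apply (is_lim_seq_sum_n
      (fun N k => b k ^ 2 * mobius_apply r N x k ^ 2)).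
    intros k. apply (is_lim_seq_scal_l _ (b k ^ 2) (mobius_limit r x k ^ 2)).
    assert (Hl : is_lim_seq (fun N => mobius_apply r N x k) (mobius_limit r x k))
      by exact (Series_correct _ (mobius_row_convergent k)).
    replace (mobius_limit r x k ^ 2)
      with (mobius_limit r x k * mobius_limit r x k) by ring.
    eapply is_lim_seq_ext; [|exact (is_lim_seq_mult' _ _ _ _ Hl Hl)].
    intros; simpl; ring.
  - apply is_lim_seq_const.
Qed.

End InfiniteSequences.

(** The difference of the two values is the image of the tail [drop_first N x], so boundedness
    applied to the tail controls it by the remaining energy. *)
Lemma mobius_limit_tail (b x : nat -> R) (r B : R) (N k : nat) :
  (forall k, 0 < b k) -> 0 < B ->
  (forall N x K,
    sum_n (fun k => b k ^ 2 * mobius_apply r N x k ^ 2) K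
    <= B * sum_n (fun n => b n ^ 2 * x n ^ 2) N) ->
  ex_series (fun n => b n ^ 2 * x n ^ 2) ->
  b k ^ 2 * (mobius_limit r x k - mobius_apply r N x k) ^ 2
  <= B * (Series (fun n => b n ^ 2 * x n ^ 2)
          - sum_n (fun n => b n ^ 2 * x n ^ 2) N).
Proof.
  intros Hb HB Hbound Hx.
  assert (H1 : is_series (fun n => b n ^ 2 * drop_first N x n ^ 2)
    (Series (fun n => b n ^ 2 * x n ^ 2) - sum_n (fun n => b n ^ 2 * x n ^ 2) N)).
  { eapply is_series_ext; [|apply is_series_drop_first, Series_correct, Hx].
    intros n. unfold drop_first. destruct (Nat.leb n N); real_eq; ring. }
  assert (H2 : mobius_limit r (drop_first N x) k
               = mobius_limit r x k - mobius_apply r N x k).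
  { apply is_series_unique. eapply is_series_ext;
      [|apply is_series_drop_first, Series_correct,
          (mobius_row_convergent Hb HB Hbound Hx)].
    intros n. unfold drop_first. destruct (Nat.leb n N); real_eq; ring. }
  assert (Hx' : ex_series (fun n => b n ^ 2 * drop_first N x n ^ 2))
    by (eexists; exact H1).
  assert (H := mobius_limit_bounded Hb HB Hbound Hx' k).
  rewrite (is_series_unique _ _ H1) in H.
  eapply Rle_trans; [|exact H]. rewrite <- H2.
  set (f := fun k => b k ^ 2 * mobius_limit r (drop_first N x) k ^ 2).
  change (f k <= sum_n f k). apply le_sum_n.
  intros; apply Rmult_le_pos; apply pow2_ge_0.
Qed.

(** * Complex series *)

Definition Cseries (u : nat -> C) (l : C) : Prop :=
  @is_series C_AbsRing C_NormedModule u l.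

Definition Csum (u : nat -> C) (n : nat) : C := @sum_n C_AbelianMonoid u n.

Lemma Csum_0 (u : nat -> C) : Csum u 0 = u O.
Proof. exact (sum_O (G := C_AbelianMonoid) u). Qed.

Lemma Csum_S (u : nat -> C) (n : nat) : Csum u (S n) = (Csum u n + u (S n))%C.
Proof. exact (sum_Sn (G := C_AbelianMonoid) u n). Qed.

Lemma Cconj_RtoC (x : R) : Cconj (RtoC x) = RtoC x.
Proof. unfold Cconj, RtoC; simpl; rewrite Ropp_0; reflexivity. Qed.

Lemma Cmod_sub_sym (x y : C) : Cmod (x - y) = Cmod (y - x).
Proof. rewrite <- Cmod_opp. f_equal. ring. Qed.

Lemma Cseries_spec (u : nat -> C) (l : C) :
  Cseries u l <->
  forall eps, 0 < eps ->
    exists N, forall n, (N <= n)%nat -> Cmod (Csum u n - l) < eps.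
Proof.
  split.
  - intros H eps Heps.
    (* Balls of [C] are products of balls of [R]; passing from them to [Cmod] costs a factor
       [sqrt 2]. *)
    assert (Hs : 0 < sqrt 2) by (apply sqrt_lt_R0; lra).
    assert (He : 0 < eps / sqrt 2) by (apply Rdiv_lt_0_compat; assumption).
    destruct (proj1 (filterlim_locally _ _) H (mkposreal _ He)) as [N HN].
    exists N. intros n Hn.
    assert (HB := C_NormedModule_mixin_compat2 _ _ _ (HN n Hn)).
    simpl in HB. replace (sqrt 2 * (eps / sqrt 2)) with eps in HB by (field; lra).
    exact HB.
  - intros H. apply (proj2 (filterlim_locally _ _)). intros eps.
    destruct (H eps (cond_pos eps)) as [N HN]. exists N. intros n Hn.
    apply C_NormedModule_mixin_compat1. exact (HN n Hn).
Qed.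

Lemma Cseries_unique (u : nat -> C) (l1 l2 : C) :
  Cseries u l1 -> Cseries u l2 -> l1 = l2.
Proof.
  intros H1 H2. apply NNPP. intros Hne.
  assert (Hd : 0 < Cmod (l1 - l2)).
  { apply Cmod_gt_0. apply Cminus_eq_contra, Hne. }
  destruct (proj1 (Cseries_spec _ _) H1 (Cmod (l1 - l2) / 2)) as [N1 HN1]; [lra|].
  destruct (proj1 (Cseries_spec _ _) H2 (Cmod (l1 - l2) / 2)) as [N2 HN2]; [lra|].
  specialize (HN1 (N1 + N2)%nat ltac:(lia)). specialize (HN2 (N1 + N2)%nat ltac:(lia)).
  set (s := Csum u (N1 + N2)) in *.
  assert (H := Cmod_triangle (l1 - s) (s - l2)).
  rewrite (Cmod_sub_sym l1 s) in H.
  replace (l1 - s + (s - l2))%C with (l1 - l2)%C in H by ring. lra.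
Qed.

Lemma Cseries_ext (u v : nat -> C) (l : C) :
  (forall n, u n = v n) -> Cseries u l -> Cseries v l.
Proof. apply (is_series_ext (V := C_NormedModule)). Qed.

Lemma Cseries_plus (u v : nat -> C) (l m : C) :
  Cseries u l -> Cseries v m -> Cseries (fun n => u n + v n)%C (l + m)%C.
Proof. apply (is_series_plus (V := C_NormedModule)). Qed.

Lemma Cseries_scal (c : C) (u : nat -> C) (l : C) :
  Cseries u l -> Cseries (fun n => c * u n)%C (c * l)%C.
Proof. apply (is_series_scal (V := C_NormedModule)). Qed.

Lemma Cseries_decr (u : nat -> C) (l : C) :
  Cseries (fun n => u (S n)) (l - u O)%C -> Cseries u l.
Proof. apply (is_series_decr_1 (V := C_NormedModule)). Qed.

Lemma Cseries_incr (u : nat -> C) (l : C) :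
  Cseries u l -> Cseries (fun n => u (S n)) (l - u O)%C.
Proof.
  intros H. apply (is_series_incr_1 (V := C_NormedModule) u (l - u O)%C).
  evar_last; [exact H|]. change (@eq C l (l - u O + u O)%C). ring.
Qed.

Lemma Cseries_zero : Cseries (fun _ => RtoC 0) (RtoC 0).
Proof.
  apply Cseries_spec. intros eps Heps. exists O. intros n _.
  replace (Csum (fun _ => RtoC 0) n) with (RtoC 0).
  - replace (0 - 0)%C with (RtoC 0) by ring. rewrite Cmod_0. exact Heps.
  - induction n as [|n IH]; [rewrite Csum_0; reflexivity|].
    rewrite Csum_S, <- IH. ring.
Qed.

Lemma Cseries_dominated (u : nat -> C) (v : nat -> R) :
  (forall n, Cmod (u n) <= v n) -> ex_series v -> exists l, Cseries u l.
Proof. apply (ex_series_le (V := C_CompleteNormedModule) u v). Qed.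

Lemma Csum_Cmod (u : nat -> C) (n : nat) :
  Cmod (Csum u n) <= sum_n (fun k => Cmod (u k)) n.
Proof.
  induction n as [|n IH]; [rewrite Csum_0, sum_n_0; lra|].
  rewrite Csum_S, sum_n_S. eapply Rle_trans; [apply Cmod_triangle|]. lra.
Qed.

Lemma Cseries_Cmod_le (u : nat -> C) (v : nat -> R) (l : C) :
  (forall n, Cmod (u n) <= v n) -> ex_series v -> Cseries u l ->
  Cmod l <= Series v.
Proof.
  intros Huv Hv Hl. apply Rnot_lt_le. intros Hlt.
  destruct (proj1 (Cseries_spec _ _) Hl (Cmod l - Series v)) as [N HN]; [lra|].
  specialize (HN N (Nat.le_refl _)).
  assert (H1 : Cmod (Csum u N) <= Series v).
  { eapply Rle_trans; [apply Csum_Cmod|].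
    eapply Rle_trans; [|apply sum_n_le_Series; [|exact Hv]].
    - clear HN. induction N as [|N IH]; [rewrite !sum_n_0; apply Huv|].
      rewrite !sum_n_S. apply Rplus_le_compat; [exact IH|apply Huv].
    - intros k. eapply Rle_trans; [apply Cmod_ge_0|apply Huv]. }
  assert (H2 := Cmod_triangle (Csum u N) (l - Csum u N)).
  rewrite (Cmod_sub_sym l) in H2.
  replace (Csum u N + (l - Csum u N))%C with l in H2 by ring. lra.
Qed.

Lemma Cseries_sum (u : nat -> nat -> C) (l : nat -> C) (N : nat) :
  (forall n, Cseries (u n) (l n)) ->
  Cseries (fun k => Csum (fun n => u n k) N) (Csum l N).
Proof.
  intros H. induction N as [|N IH].
  - rewrite Csum_0. apply (Cseries_ext (u O)); [|apply H].
    intros k; symmetry; apply (Csum_0 (fun n => u n k)).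
  - rewrite Csum_S.
    apply (Cseries_ext (fun k => Csum (fun n => u n k) N + u (S N) k)%C).
    + intros k; symmetry; apply (Csum_S (fun n => u n k)).
    + apply Cseries_plus; [exact IH|apply H].
Qed.

Lemma Cseries_Re (u : nat -> C) (l : C) :
  Cseries u l -> is_series (fun n => Re (u n)) (Re l).
Proof.
  intros H. change (is_lim_seq (sum_n (fun n => Re (u n))) (Re l)).
  apply is_lim_seq_spec. intros eps.
  destruct (proj1 (Cseries_spec _ _) H eps (cond_pos eps)) as [N HN].
  exists N. intros n Hn. eapply Rle_lt_trans; [|exact (HN n Hn)].
  eapply Rle_trans; [|apply re_le_Cmod].
  replace (sum_n (fun n => Re (u n)) n) with (Re (Csum u n)).
  - apply Req_le. reflexivity.
  - clear. induction n as [|n IH]; [rewrite Csum_0, sum_n_0; reflexivity|].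
    rewrite Csum_S, sum_n_S, <- IH. reflexivity.
Qed.

(** * Taylor coefficients and their uniqueness *)

Lemma Cpow_pow_n (z : C) (n : nat) : @pow_n C_Ring z n = (z ^ n)%C.
Proof. induction n as [|n IH]; [reflexivity|]. simpl. rewrite IH. reflexivity. Qed.

Lemma has_taylor_Cseries (a : nat -> C) (f : dfun) :
  has_taylor a f <->
  forall z : disk, Cseries (fun k => (disk_val z ^ k * a k)%C) (f z).
Proof.
  split; intros H z; specialize (H z);
    (eapply (is_series_ext (V := C_NormedModule)); [|exact H]);
    intros n; rewrite <- Cpow_pow_n; reflexivity.
Qed.

Lemma real_pseries_zero (a : nat -> R) :
  (forall x, Rabs x < 1 -> is_series (fun k => x ^ k * a k) 0) ->
  forall n, a n = 0.
Proof.
  intros H n.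
  assert (HP : forall x, Rabs x < 1 -> PSeries a x = 0).
  { intros x Hx. apply is_pseries_unique, is_pseries_R.
    eapply is_series_ext; [|exact (H x Hx)]. intros; apply Rmult_comm. }
  (* Convergence at [1 / 2] rules out a smaller radius of convergence, and the uniqueness of real
     coefficients requires a positive one. *)
  assert (HR : Rbar_lt 0 (CV_radius a)).
  { apply Rbar_lt_le_trans with (Rabs (1 / 2)).
    - rewrite Rabs_pos_eq by lra. simpl; lra.
    - apply Rbar_not_lt_le. intros Hlt. apply (CV_disk_outside _ _ Hlt).
      apply ex_series_lim_0. exists 0.
      eapply is_series_ext; [|apply (H (1 / 2)); rewrite Rabs_pos_eq; lra].
      intros; apply Rmult_comm. }
  apply (PSeries_ext_recip a (fun _ => 0) n HR).
  - replace (CV_radius (fun _ => 0)) with p_infty; [exact I|].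
    symmetry; apply CV_radius_const_0.
  - exists (mkposreal 1 Rlt_0_1). intros x Hx. rewrite PSeries_const_0.
    apply HP. change (Rabs (x - 0) < 1) in Hx. rewrite Rminus_0_r in Hx. exact Hx.
Qed.

Lemma RtoC_disk (x : R) : Rabs x < 1 -> Cmod (RtoC x) < 1.
Proof. rewrite Cmod_R. trivial. Qed.

(** Real points of the disk suffice: multiplying by [c = 1] and by [c = - Ci] before taking real
    parts yields two real power series, carrying the real and the imaginary parts of the
    coefficients. *)
Lemma taylor_zero_unique (a : nat -> C) :
  has_taylor a dzero -> forall n, a n = RtoC 0.
Proof.
  intros H n.
  assert (Hser : forall (c : C) x, Rabs x < 1 ->
     is_series (fun k => x ^ k * Re (c * a k)) 0).
  { intros c x Hx.
    assert (Hx' := proj1 (has_taylor_Cseries _ _) H (exist _ _ (RtoC_disk x Hx))).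
    apply (Cseries_scal c), Cseries_Re in Hx'.
    replace 0 with (Re (c * dzero (exist (fun z => Cmod z < 1) _ (RtoC_disk x Hx)))).
    - eapply is_series_ext; [|exact Hx']. intros k. cbn [disk_val proj1_sig].
      rewrite <- RtoC_pow.
      replace (c * (RtoC (x ^ k) * a k))%C with (RtoC (x ^ k) * (c * a k))%C by ring.
      apply re_scal_l.
    - unfold dzero. rewrite Cmult_0_r. reflexivity. }
  assert (H1 := real_pseries_zero _ (Hser (RtoC 1)) n).
  assert (H2 := real_pseries_zero _ (Hser (- Ci)%C) n).
  unfold Re, Cmult, Copp, Ci, RtoC in *. simpl in H1, H2.
  apply injective_projections; simpl; lra.
Qed.

Lemma has_taylor_unique (a b : nat -> C) (f : dfun) :
  has_taylor a f -> has_taylor b f -> a = b.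
Proof.
  intros Ha Hb. apply functional_extensionality. intros n.
  apply Ceq_minus.
  apply (taylor_zero_unique (fun n => a n - b n)%C).
  apply has_taylor_Cseries. intros z.
  replace (dzero z) with (f z + (-(1)) * f z)%C by (unfold dzero; ring).
  eapply Cseries_ext; [|apply Cseries_plus;
    [apply (proj1 (has_taylor_Cseries _ _) Ha)
    |apply Cseries_scal, (proj1 (has_taylor_Cseries _ _) Hb)]].
  intros k; cbv beta; ring.
Qed.

Lemma has_taylor_taylor (a : nat -> C) (f : dfun) :
  has_taylor a f -> taylor f = a.
Proof.
  intros Ha. apply (has_taylor_unique _ _ f); [|exact Ha].
  unfold taylor. apply epsilon_spec. exists a; exact Ha.
Qed.

(** * Disk involutions *)

Definition psi (a z : C) : C := ((a - z) / (1 - Cconj a * z))%C.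

Lemma psi_den_nz (a z : C) :
  Cmod a < 1 -> Cmod z < 1 -> (1 - Cconj a * z)%C <> RtoC 0.
Proof.
  intros Ha Hz H. apply Ceq_minus in H.
  assert (H' := f_equal Cmod H). rewrite Cmod_1, Cmod_mult, Cmod_conj in H'.
  assert (H1 := Cmod_ge_0 a). assert (H2 := Cmod_ge_0 z). nra.
Qed.

Lemma psi_Cmod_lt_1 (a z : C) : Cmod a < 1 -> Cmod z < 1 -> Cmod (psi a z) < 1.
Proof.
  intros Ha Hz. assert (Hd := psi_den_nz a z Ha Hz).
  unfold psi. rewrite Cmod_div by exact Hd.
  assert (Hp : 0 < Cmod (1 - Cconj a * z)) by (apply Cmod_gt_0, Hd).
  apply Rmult_lt_reg_r with (Cmod (1 - Cconj a * z)); [exact Hp|].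
  unfold Rdiv. rewrite Rmult_assoc, Rinv_l, Rmult_1_r, Rmult_1_l by lra.
  apply Rsqr_incrst_0; try apply Cmod_ge_0.
  rewrite !Rsqr_pow2.
  assert (H : Cmod (1 - Cconj a * z) ^ 2 - Cmod (a - z) ^ 2
              = (1 - Cmod a ^ 2) * (1 - Cmod z ^ 2)).
  { rewrite !Cmod2_alt. destruct a as [p q], z as [x y]. simpl. ring. }
  assert (H1 := Cmod_ge_0 a). assert (H2 := Cmod_ge_0 z).
  assert (0 < (1 - Cmod a ^ 2) * (1 - Cmod z ^ 2)); [|lra].
  apply Rmult_lt_0_compat; nra.
Qed.

Lemma psi_psi (a z : C) : Cmod a < 1 -> Cmod z < 1 -> psi a (psi a z) = z.
Proof.
  intros Ha Hz. assert (Hd := psi_den_nz a z Ha Hz).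
  assert (Hd' := psi_den_nz a a Ha Ha).
  assert (Hdd := psi_den_nz a _ Ha (psi_Cmod_lt_1 a z Ha Hz)).
  unfold psi in *. field. split; [exact Hd|].
  intros H. apply Hd'. rewrite <- H. ring.
Qed.

(** * Composition on power series with real coefficients *)

(** Here [psi r (- z)] is [(z + r) / (1 + r z)]. Convergence comes first, from the decay of the
    coefficients; only then does the recursion determine the sum [T], through the linear equation
    [T (1 + r z) = (z + r) P]. *)
Lemma mobius_coef_series (r : R) (n : nat) (z : C) :
  0 <= r < 1 -> Cmod z < 1 ->
  Cseries (fun k => (z ^ k * RtoC (mobius_coef r n k))%C)
    (psi (RtoC r) (- z) ^ n)%C.
Proof.
  intros Hr Hz.
  assert (Hr' : Cmod (RtoC r) < 1) by (rewrite Cmod_R, Rabs_pos_eq; lra).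
  assert (Hz' : Cmod (- z) < 1) by (rewrite Cmod_opp; exact Hz).
  assert (Hd := psi_den_nz _ _ Hr' Hz').
  replace (Cconj (RtoC r)) with (RtoC r) in Hd
    by (rewrite Cconj_RtoC; reflexivity).
  induction n as [|n IH].
  - apply Cseries_decr.
    replace (psi r (- z) ^ 0 - z ^ 0 * mobius_coef r 0 0)%C with (RtoC 0)
      by (simpl; ring).
    eapply Cseries_ext; [|exact Cseries_zero]. intros k; simpl; ring.
  - set (a := mobius_coef r n) in *.
    set (P := (psi r (- z) ^ n)%C) in *.
    change (mobius_coef r (S n)) with (mobius_step r a).
    assert (Hex : exists S, Cseries (fun k => (z ^ k * RtoC (mobius_step r a k))%C) S).
    { set (s := (1 + r) / 2). assert (Hs : r < s < 1) by (unfold s; lra).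
      set (M := ((1 + s) / (s - r)) ^ Datatypes.S n).
      assert (HM : 0 <= M) by (apply pow_le, Rdiv_le_0_compat; lra).
      apply (Cseries_dominated _ (fun k => M * s ^ k)).
      - intros k. rewrite Cmod_mult, Cmod_pow, Cmod_R.
        assert (H1 := mobius_coef_decay r s r (S n) k ltac:(lra) ltac:(lra) ltac:(lra)).
        fold M in H1. change (mobius_coef r (S n)) with (mobius_step r a) in H1.
        assert (H2 : 0 <= Cmod z ^ k) by (apply pow_le, Cmod_ge_0).
        assert (H3 : Cmod z ^ k <= 1).
        { rewrite <- (pow1 k). apply pow_incr. split; [apply Cmod_ge_0|lra]. }
        assert (H4 := Rabs_pos (mobius_step r a k)). nra.
      - apply (ex_series_scal_l (V := R_NormedModule)).
        apply ex_series_geom. rewrite Rabs_pos_eq; lra. }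
    destruct Hex as [T HT].
    assert (HT' : (T - r * a O)%C = (z * P + r * (P - a O) - r * z * T)%C).
    { assert (H1 := Cseries_incr _ _ HT). cbv beta in H1.
      assert (H2 := Cseries_incr _ _ IH). cbv beta in H2.
      eapply Cseries_unique.
      - eapply Cseries_ext; [intros; reflexivity|].
        replace (T - r * a O)%C with (T - z ^ 0 * mobius_step r a 0)%C
          by (simpl; rewrite RtoC_mult; ring).
        exact H1.
      - replace (z * P + r * (P - a O) - r * z * T)%C
          with (z * P + r * (P - z ^ 0 * a O) + (- r * z) * T)%C by (simpl; ring).
        eapply Cseries_ext; [|apply Cseries_plus; [apply Cseries_plus|]].
        2:{ apply (Cseries_scal z). exact IH. }
        2:{ apply (Cseries_scal r). exact H2. }
        2:{ apply (Cseries_scal (- r * z)%C). exact HT. }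
        intros k. cbv beta. cbn [mobius_step].
        rewrite RtoC_minus, RtoC_plus, !RtoC_mult. simpl. ring. }
    replace (psi r (- z) ^ S n)%C with T; [exact HT|].
    rewrite Cpow_S. fold P.
    assert (HT2 : (T * (1 - r * - z))%C = ((z + r) * P)%C).
    { replace (T * (1 - r * - z))%C
        with ((T - r * a O) + r * a O + r * z * T)%C by ring.
      rewrite HT'. ring. }
    unfold psi.
    replace (Cconj (RtoC r)) with (RtoC r)
      by (rewrite Cconj_RtoC; reflexivity).
    replace T with (T * (1 - r * - z) / (1 - r * - z))%C by (field; exact Hd).
    rewrite HT2. field. exact Hd.
Qed.

Lemma mobius_apply_Csum (r : R) (N : nat) (x : nat -> R) (z : C) (k : nat) :
  (z ^ k * RtoC (mobius_apply r N x k))%C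
  = Csum (fun n => (RtoC (x n) * (z ^ k * RtoC (mobius_coef r n k)))%C) N.
Proof.
  unfold mobius_apply. induction N as [|N IH].
  - rewrite sum_n_0, Csum_0, RtoC_mult. ring.
  - rewrite sum_n_S, Csum_S, <- IH, RtoC_plus, RtoC_mult. ring.
Qed.

(** For partial sums of [F] the formula is a finite combination of known series. Replacing limit
    coefficients by truncated ones costs at most [sqrt (tail N) / b_k] in the entry [k], and this is
    summable against [|z|^k], so the error in the sum tends to 0 with [N]. *)
Lemma mobius_limit_series (b x : nat -> R) (r B : R) (F : C -> C) :
  (forall k, 0 < b k) ->
  (forall rho, 0 <= rho < 1 -> ex_series (fun k => rho ^ k / b k)) ->
  0 < B ->
  (forall N x K,
    sum_n (fun k => b k ^ 2 * mobius_apply r N x k ^ 2) K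
    <= B * sum_n (fun n => b n ^ 2 * x n ^ 2) N) ->
  0 <= r < 1 ->
  ex_series (fun n => b n ^ 2 * x n ^ 2) ->
  (forall v, Cmod v < 1 -> Cseries (fun n => (v ^ n * RtoC (x n))%C) (F v)) ->
  forall z, Cmod z < 1 ->
    Cseries (fun k => (z ^ k * RtoC (mobius_limit r x k))%C)
      (F (psi (RtoC r) (- z))).
Proof.
  intros Hb Hgeom HB Hbound Hr Hx HF z Hz.
  set (E := Series (fun n => b n ^ 2 * x n ^ 2)).
  set (y := mobius_limit r x).
  set (tail := fun N => B * (E - sum_n (fun n => b n ^ 2 * x n ^ 2) N)).
  assert (Htail : forall N k,
    Rabs (y k - mobius_apply r N x k) <= sqrt (tail N) * / b k).
  { intros N k. assert (H := mobius_limit_tail b x r B N k Hb HB Hbound Hx).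
    fold E y (tail N) in H.
    apply Rmult_le_reg_l with (b k); [apply Hb|].
    replace (b k * (sqrt (tail N) * / b k)) with (sqrt (tail N))
      by (field; apply Rgt_not_eq, Hb).
    rewrite <- (Rabs_pos_eq (b k)) at 1 by apply Rlt_le, Hb.
    rewrite <- Rabs_mult, <- sqrt_Rsqr_abs. apply sqrt_le_1_alt.
    rewrite Rsqr_pow2, Rpow_mult_distr. exact H. }
  assert (Hz0 := Cmod_ge_0 z).
  assert (HG := Hgeom (Cmod z) (conj Hz0 Hz)).
  assert (Hdiff : forall N k,
    Cmod (z ^ k * RtoC (y k - mobius_apply r N x k))
    <= sqrt (tail N) * (Cmod z ^ k / b k)).
  { intros N k. rewrite Cmod_mult, Cmod_pow, Cmod_R.
    replace (sqrt (tail N) * (Cmod z ^ k / b k))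
      with (Cmod z ^ k * (sqrt (tail N) * / b k))
      by (field; apply Rgt_not_eq, Hb).
    apply Rmult_le_compat_l; [apply pow_le; exact Hz0|apply Htail]. }
  set (v := psi (RtoC r) (- z)).
  assert (Hv : Cmod v < 1).
  { apply psi_Cmod_lt_1; [rewrite Cmod_R, Rabs_pos_eq; lra|].
    rewrite Cmod_opp; exact Hz. }
  assert (Hfin : forall N, Cseries (fun k => (z ^ k * RtoC (mobius_apply r N x k))%C)
     (Csum (fun n => (v ^ n * RtoC (x n))%C) N)).
  { intros N.
    eapply Cseries_ext; [intros k; symmetry; apply mobius_apply_Csum|].
    replace (Csum (fun n => (v ^ n * RtoC (x n))%C) N)
      with (Csum (fun n => (RtoC (x n) * v ^ n)%C) N).
    - apply Cseries_sum. intros n. apply Cseries_scal.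
      apply mobius_coef_series; assumption.
    - apply (sum_n_ext (G := C_AbelianMonoid)). intros n.
      apply (Cmult_comm (RtoC (x n))). }
  assert (HD : forall N, exists D,
     Cseries (fun k => (z ^ k * RtoC (y k - mobius_apply r N x k))%C) D
     /\ Cmod D <= sqrt (tail N) * Series (fun k => Cmod z ^ k / b k)).
  { intros N.
    assert (Hex : ex_series (fun k => sqrt (tail N) * (Cmod z ^ k / b k)))
      by (apply (ex_series_scal_l (V := R_NormedModule)); exact HG).
    destruct (Cseries_dominated _ _ (Hdiff N) Hex) as [D HDN].
    exists D. split; [exact HDN|].
    rewrite <- Series_scal_l. apply (Cseries_Cmod_le _ _ _ (Hdiff N) Hex HDN). }
  (* Convergence with the limit coefficients follows already from [N = 0], as a dominated error
     series plus a series of truncated coefficients. *)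
  assert (Hex : exists T, Cseries (fun k => (z ^ k * RtoC (y k))%C) T).
  { destruct (HD O) as [D [HD0 _]]. eexists.
    eapply Cseries_ext; [|exact (Cseries_plus _ _ _ _ HD0 (Hfin O))].
    intros k; cbv beta. rewrite RtoC_minus. ring. }
  destruct Hex as [T HT].
  replace (F v) with T; [exact HT|].
  assert (Htail0 : is_lim_seq (fun N => sqrt (tail N) * Series (fun k => Cmod z ^ k / b k)) 0).
  { assert (H1 : is_lim_seq tail (B * (E - E))).
    { apply (is_lim_seq_scal_l _ B (E - E)).
      apply is_lim_seq_minus'; [apply is_lim_seq_const|].
      exact (Series_correct _ Hx). }
    replace (B * (E - E)) with 0 in H1 by ring.
    assert (H2 : is_lim_seq (fun N => sqrt (tail N)) (sqrt 0)).
    { apply is_lim_seq_continuous; [|exact H1].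
      apply continuity_pt_filterlim, continuous_sqrt. }
    rewrite sqrt_0 in H2.
    replace 0 with (0 * Series (fun k => Cmod z ^ k / b k)) by ring.
    apply is_lim_seq_mult'; [exact H2|apply is_lim_seq_const]. }
  apply NNPP. intros Hne.
  assert (Hpos : 0 < Cmod (T - F v)) by (apply Cmod_gt_0, Cminus_eq_contra, Hne).
  apply is_lim_seq_spec in Htail0.
  destruct (Htail0 (mkposreal (Cmod (T - F v) / 2) ltac:(lra))) as [N1 HN1].
  destruct (proj1 (Cseries_spec _ _) (HF v Hv) (Cmod (T - F v) / 2)) as [N2 HN2]; [lra|].
  set (N := (N1 + N2)%nat).
  specialize (HN1 N ltac:(unfold N; lia)). specialize (HN2 N ltac:(unfold N; lia)).
  simpl in HN1. rewrite Rminus_0_r in HN1.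
  destruct (HD N) as [D [HDN HDle]].
  assert (HTD : T = (D + Csum (fun n => (v ^ n * RtoC (x n))%C) N)%C).
  { eapply Cseries_unique; [exact HT|].
    eapply Cseries_ext; [|exact (Cseries_plus _ _ _ _ HDN (Hfin N))].
    intros k; cbv beta. rewrite RtoC_minus. ring. }
  assert (H := Cmod_triangle D (Csum (fun n => (v ^ n * RtoC (x n))%C) N - F v)).
  replace (D + (Csum (fun n => (v ^ n * RtoC (x n))%C) N - F v))%C
    with (T - F v)%C in H by (rewrite HTD; ring).
  assert (H' := Rle_abs (sqrt (tail N) * Series (fun k => Cmod z ^ k / b k))).
  lra.
Qed.

(** * Coefficients of functions in the weighted Hardy space *)

Definition energy (w : nat -> R) (c : nat -> C) : R :=
  Series (fun k => Cmod (c k) ^ 2 * beta w k ^ 2).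

Definition finite_energy (w : nat -> R) (c : nat -> C) : Prop :=
  ex_series (fun k => Cmod (c k) ^ 2 * beta w k ^ 2).

(** Since [taylor] is obtained by choice, it is easier to carry a coefficient sequence explicitly
    and to identify it with [taylor f] afterwards by uniqueness. *)
Definition hardy_coef (w : nat -> R) (c : nat -> C) (f : dfun) : Prop :=
  has_taylor c f /\ finite_energy w c.

Lemma hardy_coef_taylor (w : nat -> R) (c : nat -> C) (f : dfun) :
  hardy_coef w c f -> taylor f = c.
Proof. intros [H _]. apply has_taylor_taylor, H. Qed.

Lemma hardy_coef_hardy (w : nat -> R) (c : nat -> C) (f : dfun) :
  hardy_coef w c f -> hardy w f.
Proof.
  intros H. unfold hardy. rewrite (hardy_coef_taylor w c f H). exact H.
Qed.

Lemma has_taylor_eq (c : nat -> C) (f g : dfun) :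
  has_taylor c f -> has_taylor c g -> f = g.
Proof.
  intros Hf Hg. apply functional_extensionality. intros z.
  eapply Cseries_unique; eapply has_taylor_Cseries; eassumption.
Qed.

Lemma energy_term_nonneg (w : nat -> R) (c : nat -> C) (k : nat) :
  0 <= Cmod (c k) ^ 2 * beta w k ^ 2.
Proof. apply Rmult_le_pos; apply pow2_ge_0. Qed.

Lemma energy_nonneg (w : nat -> R) (c : nat -> C) :
  finite_energy w c -> 0 <= energy w c.
Proof.
  intros H. eapply Rle_trans; [|apply (sum_n_le_Series _ O); [|exact H]].
  - apply sum_n_nonneg. apply energy_term_nonneg.
  - apply energy_term_nonneg.
Qed.

Lemma energy_term_le (w : nat -> R) (c : nat -> C) (k : nat) :
  finite_energy w c -> Cmod (c k) ^ 2 * beta w k ^ 2 <= energy w c.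
Proof.
  intros H. eapply Rle_trans; [|apply (sum_n_le_Series _ k); [|exact H]].
  - exact (le_sum_n _ k (energy_term_nonneg w c)).
  - apply energy_term_nonneg.
Qed.

Lemma finite_energy_series (w : nat -> R) (c : nat -> C) (z : C) :
  is_weight w -> finite_energy w c -> Cmod z < 1 ->
  exists l, Cseries (fun k => (z ^ k * c k)%C) l.
Proof.
  intros Hw Hc Hz.
  apply (Cseries_dominated _ (fun k => sqrt (energy w c) * (Cmod z ^ k / beta w k))).
  - intros k. rewrite Cmod_mult, Cmod_pow.
    assert (Hb := beta_pos w k Hw).
    assert (H : Cmod (c k) * beta w k <= sqrt (energy w c)).
    { rewrite <- (sqrt_pow2 (Cmod (c k) * beta w k)).
      - apply sqrt_le_1_alt. rewrite Rpow_mult_distr. apply energy_term_le, Hc.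
      - apply Rmult_le_pos; [apply Cmod_ge_0|lra]. }
    replace (Cmod z ^ k * Cmod (c k))
      with (Cmod (c k) * beta w k * (Cmod z ^ k / beta w k)) by (field; lra).
    apply Rmult_le_compat_r; [|exact H].
    apply Rdiv_le_0_compat; [apply pow_le, Cmod_ge_0|exact Hb].
  - apply (ex_series_scal_l (V := R_NormedModule)), ex_series_geom_beta; [exact Hw|].
    split; [apply Cmod_ge_0|exact Hz].
Qed.

Lemma finite_energy_le (w : nat -> R) (c d : nat -> C) (M : R) :
  (forall k, Cmod (d k) <= M * Cmod (c k)) -> finite_energy w c ->
  finite_energy w d /\ energy w d <= M ^ 2 * energy w c.
Proof.
  intros Hd Hc.
  assert (Hex : ex_series (fun k => M ^ 2 * (Cmod (c k) ^ 2 * beta w k ^ 2)))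
    by (apply (ex_series_scal_l (V := R_NormedModule)); exact Hc).
  assert (Hle : forall k, Cmod (d k) ^ 2 * beta w k ^ 2
                <= M ^ 2 * (Cmod (c k) ^ 2 * beta w k ^ 2)).
  { intros k. rewrite <- Rmult_assoc, <- (Rpow_mult_distr M).
    apply Rmult_le_compat_r; [apply pow2_ge_0|].
    apply pow_incr. split; [apply Cmod_ge_0|apply Hd]. }
  split.
  - apply (ex_series_le (V := R_CompleteNormedModule) _ _) with (2 := Hex).
    intros k. change (norm ?u) with (Rabs u).
    rewrite Rabs_pos_eq by apply energy_term_nonneg. apply Hle.
  - unfold energy. rewrite <- Series_scal_l. apply Series_le; [|exact Hex].
    intros k. split; [apply energy_term_nonneg|apply Hle].
Qed.

Lemma hardy_coef_plus (w : nat -> R) (c d : nat -> C) (f g : dfun) :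
  hardy_coef w c f -> hardy_coef w d g ->
  hardy_coef w (fun k => c k + d k)%C (dplus f g).
Proof.
  intros [Hf Hc] [Hg Hd]. split.
  - apply has_taylor_Cseries. intros z.
    eapply Cseries_ext; [|apply Cseries_plus;
      [apply (proj1 (has_taylor_Cseries _ _) Hf)
      |apply (proj1 (has_taylor_Cseries _ _) Hg)]].
    intros k; cbv beta; ring.
  - apply (ex_series_le (V := R_CompleteNormedModule) _
      (fun k => 2 * (Cmod (c k) ^ 2 * beta w k ^ 2 + Cmod (d k) ^ 2 * beta w k ^ 2))).
    + intros k. change (norm ?u) with (Rabs u).
      rewrite Rabs_pos_eq by apply (energy_term_nonneg w (fun k => c k + d k)%C).
      rewrite <- Rmult_plus_distr_r, <- Rmult_assoc.
      apply Rmult_le_compat_r; [apply pow2_ge_0|].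
      assert (H := Cmod_triangle (c k) (d k)).
      assert (H0 := Cmod_ge_0 (c k + d k)).
      assert (H1 := pow2_ge_0 (Cmod (c k) - Cmod (d k))). nra.
    + apply (ex_series_scal_l (V := R_NormedModule)).
      apply (ex_series_plus (V := R_NormedModule)); assumption.
Qed.

Lemma hardy_coef_scal (w : nat -> R) (c : nat -> C) (a : C) (f : dfun) :
  hardy_coef w c f -> hardy_coef w (fun k => a * c k)%C (dscal a f).
Proof.
  intros [Hf Hc]. split.
  - apply has_taylor_Cseries. intros z.
    eapply Cseries_ext; [|apply (Cseries_scal a),
      (proj1 (has_taylor_Cseries _ _) Hf)].
    intros k; cbv beta; ring.
  - apply (finite_energy_le w c _ (Cmod a)); [|exact Hc].
    intros k. rewrite Cmod_mult. lra.
Qed.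

(** Operators are total on [dfun], so the sum is chosen by [epsilon]; the value is meaningful when
    the multiplied series converges, as it does for bounded [d] and [f] in the Hardy space. *)
Definition diag_op (d : nat -> C) (f : dfun) : dfun :=
  fun z => epsilon (inhabits (RtoC 0))
    (fun l => Cseries (fun k => (disk_val z ^ k * (d k * taylor f k))%C) l).

Lemma hardy_coef_diag (w : nat -> R) (c d : nat -> C) (M : R) (f : dfun) :
  is_weight w -> (forall k, Cmod (d k) <= M) -> hardy_coef w c f ->
  hardy_coef w (fun k => d k * c k)%C (diag_op d f).
Proof.
  intros Hw Hd Hf.
  assert (Hdc : finite_energy w (fun k => d k * c k)%C).
  { apply (finite_energy_le w c _ M); [|exact (proj2 Hf)].
    intros k. rewrite Cmod_mult.
    apply Rmult_le_compat_r; [apply Cmod_ge_0|apply Hd]. }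
  split; [|exact Hdc].
  apply has_taylor_Cseries. intros z. unfold diag_op.
  rewrite (hardy_coef_taylor w c f Hf).
  apply (epsilon_spec (inhabits (RtoC 0))
    (fun l => Cseries (fun k => (disk_val z ^ k * (d k * c k))%C) l)).
  apply (finite_energy_series w); [exact Hw|exact Hdc|exact (proj2_sig z)].
Qed.

(** * Composition with a disk involution *)

Lemma disk_eq (x y : disk) : disk_val x = disk_val y -> x = y.
Proof.
  destruct x as [x Hx], y as [y Hy]. simpl. intros <-.
  f_equal. apply proof_irrelevance.
Qed.

Definition psi_disk (a z : disk) : disk :=
  exist _ (psi a z) (psi_Cmod_lt_1 a z (proj2_sig a) (proj2_sig z)).

Lemma psi_disk_involutive (a z : disk) : psi_disk a (psi_disk a z) = z.
Proof.
  apply disk_eq. exact (psi_psi a z (proj2_sig a) (proj2_sig z)).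
Qed.

Lemma polar (a : C) : exists u, Cmod u = 1 /\ a = (u * RtoC (Cmod a))%C.
Proof.
  destruct (Ceq_dec a 0) as [->|Ha].
  - exists (RtoC 1). rewrite Cmod_1, Cmod_0. split; [reflexivity|ring].
  - assert (Hm : 0 < Cmod a) by (apply Cmod_gt_0, Ha).
    assert (Hm' : RtoC (Cmod a) <> 0) by (intros H; apply RtoC_inj in H; lra).
    exists (a / RtoC (Cmod a))%C. split; [|field; exact Hm'].
    rewrite Cmod_div by exact Hm'. rewrite Cmod_R, Rabs_pos_eq by lra. field; lra.
Qed.

Lemma Cmod_1_conj (u : C) : Cmod u = 1 -> (u * Cconj u)%C = RtoC 1.
Proof. intros H. rewrite <- Cmod2_conj, H. f_equal. ring. Qed.

Lemma finite_energy_component (w : nat -> R) (c : nat -> C) (x : nat -> R) :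
  (forall k, x k ^ 2 <= Cmod (c k) ^ 2) -> finite_energy w c ->
  ex_series (fun k => beta w k ^ 2 * x k ^ 2).
Proof.
  intros Hx Hc.
  apply (ex_series_le (V := R_CompleteNormedModule) _ _) with (2 := Hc).
  intros k. change (norm ?u) with (Rabs u). rewrite Rabs_pos_eq.
  - rewrite Rmult_comm. apply Rmult_le_compat_r; [apply pow2_ge_0|apply Hx].
  - apply Rmult_le_pos; apply pow2_ge_0.
Qed.

(* With [alpha = u r], [|u| = 1], the involution is
   [z |-> u (r - v) / (1 - r v)] at [v = conj u z]; the real and imaginary parts
   of the rotated coefficients are treated separately. *)
Lemma hardy_coef_psi (w : nat -> R) (alpha : disk) :
  is_weight w -> polynomial_growth w ->
  exists B, 0 < B /\ forall c f, hardy_coef w c f ->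
    exists c', hardy_coef w c' (comp_op (psi_disk alpha) f)
      /\ energy w c' <= B * energy w c.
Proof.
  intros Hw Hg.
  destruct (weight_commutator w Hw Hg) as [C0 HC0].
  set (r := Cmod alpha).
  assert (Hr : 0 <= r < 1) by (split; [apply Cmod_ge_0|exact (proj2_sig alpha)]).
  assert (Hb := fun k => beta_pos w k Hw).
  destruct (mobius_apply_bounded (beta w) C0 r Hb HC0
    (fun s => beta_geom_lim w s Hw) Hr) as [B [HB Hbound]].
  exists B. split; [exact HB|]. intros c f [Hf Hc].
  destruct (polar alpha) as [u [Hu Halpha]]. fold r in Halpha.
  assert (Huu := Cmod_1_conj u Hu).
  set (x1 := fun n => Re (u ^ n * c n)). set (x2 := fun n => Im (u ^ n * c n)).
  assert (Hx : forall n, Cmod (c n) ^ 2 = x1 n ^ 2 + x2 n ^ 2).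
  { intros n. unfold x1, x2. rewrite <- Cmod2_alt, Cmod_mult, Cmod_pow, Hu, pow1.
    rewrite Rmult_1_l. reflexivity. }
  assert (Hx1 : ex_series (fun n => beta w n ^ 2 * x1 n ^ 2)).
  { apply (finite_energy_component w c); [|exact Hc].
    intros k. rewrite Hx. assert (H := pow2_ge_0 (x2 k)). lra. }
  assert (Hx2 : ex_series (fun n => beta w n ^ 2 * x2 n ^ 2)).
  { apply (finite_energy_component w c); [|exact Hc].
    intros k. rewrite Hx. assert (H := pow2_ge_0 (x1 k)). lra. }
  assert (HF : forall x, ex_series (fun n => beta w n ^ 2 * x n ^ 2) ->
    exists F : C -> C, forall v, Cmod v < 1 ->
      Cseries (fun n => (v ^ n * RtoC (x n))%C) (F v)).
  { intros x Hxs.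
    exists (fun v => epsilon (inhabits (RtoC 0))
      (fun l => Cseries (fun n => (v ^ n * RtoC (x n))%C) l)).
    intros v Hv. apply (epsilon_spec (inhabits (RtoC 0))
      (fun l => Cseries (fun n => (v ^ n * RtoC (x n))%C) l)).
    apply (finite_energy_series w); [exact Hw| |exact Hv].
    eapply ex_series_ext; [|exact Hxs]. intros n. cbv beta.
    rewrite Cmod_R, pow2_abs. real_eq. ring. }
  destruct (HF x1 Hx1) as [F1 HF1]. destruct (HF x2 Hx2) as [F2 HF2].
  assert (Hgeom := fun rho => ex_series_geom_beta w rho Hw).
  assert (HL1 := mobius_limit_series (beta w) x1 r B F1 Hb Hgeom HB Hbound Hr Hx1 HF1).
  assert (HL2 := mobius_limit_series (beta w) x2 r B F2 Hb Hgeom HB Hbound Hr Hx2 HF2).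
  set (y1 := mobius_limit r x1) in *. set (y2 := mobius_limit r x2) in *.
  (* The limit series is evaluated at [z' = - Cconj u * z]; the factor [(- Cconj u)^k] turns it into
     a series in [z], and its sign compensates the one in [psi r (- z')]. *)
  set (c' := fun k => ((- Cconj u) ^ k * (RtoC (y1 k) + Ci * RtoC (y2 k)))%C).
  assert (Hc' : forall k, Cmod (c' k) ^ 2 = y1 k ^ 2 + y2 k ^ 2).
  { intros k. unfold c'. rewrite Cmod_mult, Cmod_pow, Cmod_opp, Cmod_conj, Hu, pow1.
    rewrite Rmult_1_l, Cmod2_alt. simpl. ring. }
  (* All rotations have modulus 1, so squared moduli are sums of squared real and imaginary parts
     before and after composition, and the real constant [B] carries over unchanged. *)
  assert (HE : forall K, sum_n (fun k => Cmod (c' k) ^ 2 * beta w k ^ 2) K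
                 <= B * energy w c).
  { intros K.
    assert (H1 := mobius_limit_bounded Hb HB Hbound Hx1 K). fold y1 in H1.
    assert (H2 := mobius_limit_bounded Hb HB Hbound Hx2 K). fold y2 in H2.
    replace (energy w c) with (Series (fun n => beta w n ^ 2 * x1 n ^ 2)
      + Series (fun n => beta w n ^ 2 * x2 n ^ 2)).
    - eapply Rle_trans; [|rewrite Rmult_plus_distr_l;
        apply Rplus_le_compat; [exact H1|exact H2]].
      apply Req_le. rewrite <- (sum_n_plus (G := R_AbelianMonoid)).
      apply sum_n_ext. intros k. rewrite Hc'. unfold plus; simpl. ring.
    - rewrite <- Series_plus by assumption. apply Series_ext.
      intros n. rewrite Hx. ring. }
  assert (Hfin : finite_energy w c').
  { apply (ex_series_bounded _ (B * energy w c));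
      [apply energy_term_nonneg|exact HE]. }
  exists c'. split; [split; [|exact Hfin]|].
  - apply has_taylor_Cseries. intros z.
    set (z' := (- Cconj u * z)%C).
    assert (Hz' : Cmod z' < 1).
    { unfold z'. rewrite Cmod_mult, Cmod_opp, Cmod_conj, Hu, Rmult_1_l.
      exact (proj2_sig z). }
    set (v := psi (RtoC r) (- z')).
    assert (Hr' : Cmod (RtoC r) < 1) by (rewrite Cmod_R, Rabs_pos_eq; lra).
    assert (Hz'' : Cmod (- z') < 1) by (rewrite Cmod_opp; exact Hz').
    assert (Hv : Cmod v < 1) by (apply psi_Cmod_lt_1; assumption).
    assert (Huv : disk_val (psi_disk alpha z) = (u * v)%C).
    { assert (Hd := psi_den_nz _ _ Hr' Hz'').
      assert (Hd' := psi_den_nz alpha z (proj2_sig alpha) (proj2_sig z)).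
      change (psi alpha z = (u * v)%C). unfold v, psi in *.
      replace (Cconj (RtoC r)) with (RtoC r) in *
        by (rewrite Cconj_RtoC; reflexivity).
      replace (1 - r * - z')%C with (1 - Cconj alpha * z)%C in *.
      - unfold Cdiv. rewrite Cmult_assoc. f_equal. rewrite Halpha at 1. unfold z'.
        replace (u * (r - - (- Cconj u * z)))%C
          with (u * r - (u * Cconj u) * z)%C by ring.
        rewrite Huu. ring.
      - rewrite Halpha at 1. rewrite Cmult_conj.
        replace (Cconj (RtoC r)) with (RtoC r)
          by (rewrite Cconj_RtoC; reflexivity).
        unfold z'. ring. }
    replace (comp_op (psi_disk alpha) f z) with (F1 v + Ci * F2 v)%C.
    + eapply Cseries_ext; [|apply Cseries_plus;
        [exact (HL1 z' Hz')|apply (Cseries_scal Ci); exact (HL2 z' Hz')]].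
      intros k. cbv beta. unfold c', z'. rewrite Cpow_mult_l. ring.
    + apply (Cseries_unique (fun n => (disk_val (psi_disk alpha z) ^ n * c n)%C)).
      * eapply Cseries_ext; [|apply Cseries_plus;
          [exact (HF1 v Hv)|apply (Cseries_scal Ci); exact (HF2 v Hv)]].
        intros n. cbv beta. rewrite Huv, Cpow_mult_l.
        replace (u ^ n * v ^ n * c n)%C with (v ^ n * (u ^ n * c n))%C by ring.
        replace (u ^ n * c n)%C with (RtoC (x1 n) + Ci * RtoC (x2 n))%C; [ring|].
        unfold x1, x2. destruct (u ^ n * c n)%C as [p q].
        apply injective_projections; simpl; ring.
      * exact (proj1 (has_taylor_Cseries _ _) Hf (psi_disk alpha z)).
  - assert (Hle : Rbar_le (energy w c') (B * energy w c)); [|exact Hle].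
    apply (is_lim_seq_le (sum_n (fun k => Cmod (c' k) ^ 2 * beta w k ^ 2))
      (fun _ => B * energy w c)); [exact HE| |apply is_lim_seq_const].
    exact (Series_correct _ Hfin).
Qed.

(** * Linearization of an automorphism at its fixed point *)

Lemma unit_arg_conj (theta : R) :
  (unit_arg theta * Cconj (unit_arg theta))%C = RtoC 1.
Proof.
  assert (H := sin2_cos2 theta). unfold Rsqr in H.
  apply injective_projections; simpl; lra.
Qed.

Lemma Cmod_unit_arg (theta : R) : Cmod (unit_arg theta) = 1.
Proof.
  assert (H := unit_arg_conj theta). rewrite <- Cmod2_conj in H.
  apply RtoC_inj in H. assert (H' := Cmod_ge_0 (unit_arg theta)). nra.
Qed.

Lemma Cconj_nz (z : C) : z <> RtoC 0 -> Cconj z <> RtoC 0.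
Proof.
  intros Hz H. apply Hz. rewrite <- (Cconj_conj z), H. apply Cconj_RtoC.
Qed.

(** With [D = 1 - Cconj z0 * a], the fixed point equation gives [|a|^2 |D|^2 = |z0 - a|^2], while
    always [|D|^2 - |z0 - a|^2 = (1 - |a|^2) (1 - |z0|^2)]. Subtracting and cancelling [1 - |a|^2]
    leaves the claim. *)
Lemma mobius_fixed_den (theta : R) (z0 a : C) :
  Cmod z0 < 1 -> Cmod a < 1 -> mobius theta z0 a = a ->
  ((1 - Cconj z0 * a) * Cconj (1 - Cconj z0 * a))%C = (1 - z0 * Cconj z0)%C.
Proof.
  intros Hz0 Ha Hfix.
  assert (HD := psi_den_nz z0 a Hz0 Ha).
  assert (HN := psi_den_nz a a Ha Ha).
  assert (He := unit_arg_conj theta). unfold mobius in Hfix.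
  set (e := unit_arg theta) in *. set (D := (1 - Cconj z0 * a)%C) in *.
  assert (H1 : (a * D)%C = (e * (z0 - a))%C).
  { rewrite <- Hfix at 1. field. exact HD. }
  assert (H2 := f_equal Cconj H1). rewrite !Cmult_conj, Cminus_conj in H2.
  assert (HD' : Cconj D = (1 - z0 * Cconj a)%C).
  { unfold D. rewrite Cminus_conj, Cmult_conj, Cconj_conj, Cconj_RtoC. reflexivity. }
  set (D' := Cconj D) in *.
  assert (H3 : (Cconj a * a * (D * D'))%C = ((z0 - a) * (Cconj z0 - Cconj a))%C).
  { replace (Cconj a * a * (D * D'))%C with ((a * D) * (Cconj a * D'))%C by ring.
    rewrite H1, H2.
    replace (e * (z0 - a) * (Cconj e * (Cconj z0 - Cconj a)))%C
      with (e * Cconj e * ((z0 - a) * (Cconj z0 - Cconj a)))%C by ring.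
    rewrite He. ring. }
  assert (H4 : ((1 - Cconj a * a) * (D * D'))%C
               = ((1 - Cconj a * a) * (1 - z0 * Cconj z0))%C).
  { replace ((1 - Cconj a * a) * (D * D'))%C
      with (D * D' - Cconj a * a * (D * D'))%C by ring.
    rewrite H3, HD'. unfold D. ring. }
  replace (D * D')%C with ((1 - Cconj a * a) * (D * D') / (1 - Cconj a * a))%C
    by (field; exact HN).
  rewrite H4. field. exact HN.
Qed.

(** The derivative at the fixed point is [- e (1 - |z0|^2) / D^2] with [e = unit_arg theta]; since
    [1 - |z0|^2 = D Cconj D] there, it takes this form, from which its modulus 1 is immediate. *)
Definition multiplier (theta : R) (z0 a : C) : C :=
  (- unit_arg theta * Cconj (1 - Cconj z0 * a) / (1 - Cconj z0 * a))%C.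

Lemma Cmod_multiplier (theta : R) (z0 a : C) :
  Cmod z0 < 1 -> Cmod a < 1 -> Cmod (multiplier theta z0 a) = 1.
Proof.
  intros Hz0 Ha. assert (HD := psi_den_nz z0 a Hz0 Ha).
  unfold multiplier. rewrite Cmod_div by exact HD.
  rewrite Cmod_mult, Cmod_opp, Cmod_conj, Cmod_unit_arg. field.
  apply Rgt_not_eq, Cmod_gt_0, HD.
Qed.

(** In the coordinate [psi a] the fixed point sits at 0 and the automorphism becomes a rotation. In
    the computation both [a - p] and [1 - Cconj a * p] acquire the factor [D D'], and their quotient
    leaves [- e D' / D] times [psi a z]. *)
Lemma psi_mobius (theta : R) (z0 a z : C) :
  Cmod z0 < 1 -> Cmod a < 1 -> Cmod z < 1 -> mobius theta z0 a = a ->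
  psi a (mobius theta z0 z) = (multiplier theta z0 a * psi a z)%C.
Proof.
  intros Hz0 Ha Hz Hfix.
  assert (HDD := mobius_fixed_den theta z0 a Hz0 Ha Hfix).
  assert (HD := psi_den_nz z0 a Hz0 Ha).
  assert (HDz := psi_den_nz z0 z Hz0 Hz).
  assert (Haz := psi_den_nz a z Ha Hz).
  assert (HD' := Cconj_nz _ HD).
  assert (He := unit_arg_conj theta).
  unfold multiplier, psi. unfold mobius in *.
  set (e := unit_arg theta) in *.
  set (D := (1 - Cconj z0 * a)%C) in *. set (Dz := (1 - Cconj z0 * z)%C) in *.
  assert (HD'E : Cconj D = (1 - z0 * Cconj a)%C).
  { unfold D. rewrite Cminus_conj, Cmult_conj, Cconj_conj, Cconj_RtoC. reflexivity. }
  assert (H1 : (a * D)%C = (e * (z0 - a))%C).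
  { rewrite <- Hfix at 1. field. exact HD. }
  assert (H2 := f_equal Cconj H1). rewrite !Cmult_conj, Cminus_conj in H2.
  set (D' := Cconj D) in *.
  set (p := (e * ((z0 - z) / Dz))%C).
  assert (Hp : (p * Dz)%C = (e * (z0 - z))%C) by (unfold p; field; exact HDz).
  assert (HA : (a - p)%C = (e * (z - a) * (D * D') / (D * Dz))%C).
  { replace (a - p)%C with (((a * D) * Dz - (p * Dz) * D) / (D * Dz))%C
      by (field; split; assumption).
    f_equal. rewrite H1, Hp, HDD. unfold D, Dz. ring. }
  assert (HB : (1 - Cconj a * p)%C = ((D * D') * (1 - Cconj a * z) / (D' * Dz))%C).
  { replace (1 - Cconj a * p)%C
      with ((D' * Dz - (Cconj a * D') * (p * Dz)) / (D' * Dz))%C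
      by (field; split; assumption).
    f_equal. rewrite H2, Hp, HDD.
    replace (Cconj e * (Cconj z0 - Cconj a) * (e * (z0 - z)))%C
      with ((e * Cconj e) * ((Cconj z0 - Cconj a) * (z0 - z)))%C by ring.
    rewrite He, HD'E. unfold Dz. ring. }
  rewrite HA, HB. field. repeat split; assumption.
Qed.

(** The difference quotient minus [multiplier] equals [K Cconj z0 (z - a) / (D (1 - Cconj z0 * z))]
    with [|K| = |D|]. As the last denominator is at least [m = 1 - |z0|] in modulus, the error is at
    most [|z - a| / m]. *)
Lemma C_derive_mobius (theta : R) (z0 : C) (phi : disk -> disk) (a : disk) :
  disk_automorphism_of theta z0 phi -> phi a = a ->
  dderive (fun z => disk_val (phi z)) a = multiplier theta z0 a.
Proof.
  intros [Hz0 Hphi] Hfix.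
  assert (Ha : Cmod a < 1) by exact (proj2_sig a).
  assert (Hfix' : mobius theta z0 a = a) by (rewrite <- Hphi, Hfix; reflexivity).
  assert (HDD := mobius_fixed_den theta z0 a Hz0 Ha Hfix').
  assert (HD := psi_den_nz z0 a Hz0 Ha).
  assert (Hext : forall z, Cmod z < 1 ->
    dextend (fun z => disk_val (phi z)) z = mobius theta z0 z).
  { intros z Hz. unfold dextend. destruct (Rlt_dec (Cmod z) 1) as [h|h]; [|lra].
    rewrite Hphi. reflexivity. }
  unfold dderive, C_derive. apply is_C_lim_unique.
  set (m := 1 - Cmod z0). assert (Hm : 0 < m) by (unfold m; lra).
  assert (Hlow : forall z, Cmod z < 1 -> m <= Cmod (1 - Cconj z0 * z)).
  { intros z Hz.
    assert (H := Cmod_triangle (1 - Cconj z0 * z) (Cconj z0 * z)).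
    replace (1 - Cconj z0 * z + Cconj z0 * z)%C with (RtoC 1) in H by ring.
    rewrite Cmod_1, Cmod_mult, Cmod_conj in H.
    assert (H1 := Cmod_ge_0 z0). assert (H2 := Cmod_ge_0 z). unfold m. nra. }
  set (D := (1 - Cconj z0 * a)%C) in *.
  set (K := (- unit_arg theta * Cconj D)%C).
  set (L := / m). assert (HL : 0 < L) by (apply Rinv_0_lt_compat, Hm).
  apply filterlim_locally. intros eps.
  (* Halving absorbs the factor [sqrt 2] between balls and [Cmod]; the entry [1 - Cmod a] keeps [z]
     in the disk, where [dextend] agrees with [mobius]. *)
  set (d := Rmin (eps / L) (1 - Cmod a) / 2).
  assert (Hd : 0 < d).
  { unfold d. apply Rdiv_lt_0_compat; [|lra]. apply Rmin_glb_lt; [|lra].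
    apply Rdiv_lt_0_compat; [apply cond_pos|exact HL]. }
  exists (mkposreal d Hd). intros z Hball Hne. change C in (type of z).
  apply C_NormedModule_mixin_compat2 in Hball. simpl in Hball.
  change (minus z (disk_val a)) with (z - a)%C in Hball.
  assert (Hza : Cmod (z - a) < Rmin (eps / L) (1 - Cmod a)).
  { eapply Rlt_le_trans; [exact Hball|].
    replace (Rmin (eps / L) (1 - Cmod a)) with (2 * d) by (unfold d; field).
    apply Rmult_le_compat_r; [lra|].
    assert (H := sqrt_sqrt 2 ltac:(lra)). assert (H0 := sqrt_pos 2). nra. }
  assert (Hza1 := Rlt_le_trans _ _ _ Hza (Rmin_l _ _)).
  assert (Hza2 := Rlt_le_trans _ _ _ Hza (Rmin_r _ _)).
  assert (Hz : Cmod z < 1).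
  { assert (H := Cmod_triangle (z - a) a).
    replace (z - a + a)%C with z in H by ring. lra. }
  apply C_NormedModule_mixin_compat1.
  rewrite (Hext z Hz), (Hext a Ha).
  assert (HDz := psi_den_nz z0 z Hz0 Hz).
  assert (Hzne : (z - a)%C <> RtoC 0) by (apply Cminus_eq_contra, Hne).
  match goal with |- Cmod ?e < _ => replace e with
    (K * Cconj z0 * (z - a) / (D * (1 - Cconj z0 * z)))%C end.
  2:{ change (K * Cconj z0 * (z - a) / (D * (1 - Cconj z0 * z))
        = (mobius theta z0 z - mobius theta z0 a) / (z - a) - multiplier theta z0 a)%C.
      assert (Hq : (mobius theta z0 z - mobius theta z0 a)%C
         = (- unit_arg theta * (D * Cconj D) * (z - a) / (D * (1 - Cconj z0 * z)))%C).
      { rewrite HDD. unfold mobius. fold D. unfold D. unfold D in HD. field.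
        split; assumption. }
      rewrite Hq. unfold multiplier. fold D. unfold K. unfold D at 1 6. unfold D in HD |- *.
      field. repeat split; assumption. }
  rewrite Cmod_div by (apply Cmult_neq_0; assumption).
  rewrite !Cmod_mult, Cmod_conj.
  apply Rle_lt_trans with (L * Cmod (z - a)).
  2:{ apply Rmult_lt_compat_l with (r := L) in Hza1; [|exact HL].
      replace (L * (eps / L)) with (pos eps) in Hza1 by (field; lra). exact Hza1. }
  assert (HKD : Cmod K = Cmod D).
  { unfold K. rewrite Cmod_mult, Cmod_opp, Cmod_conj, Cmod_unit_arg. ring. }
  assert (HDp : 0 < Cmod D) by (apply Cmod_gt_0, HD).
  assert (HDzl := Hlow z Hz).
  set (q := Cmod (1 - Cconj z0 * z)) in *.
  replace (Cmod K * Cmod z0 * Cmod (z - a) / (Cmod D * q))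
    with (Cmod z0 / q * Cmod (z - a)) by (rewrite HKD; field; lra).
  apply Rmult_le_compat_r; [apply Cmod_ge_0|].
  apply Rle_trans with (1 / q).
  - apply Rmult_le_compat_r; [apply Rlt_le, Rinv_0_lt_compat; lra|lra].
  - unfold Rdiv, L. rewrite Rmult_1_l. apply Rinv_le_contravar; assumption.
Qed.

(** * The inner product *)

Lemma Cseries_Im (u : nat -> C) (l : C) :
  Cseries u l -> is_series (fun n => Im (u n)) (Im l).
Proof.
  intros H. apply (Cseries_scal (- Ci)%C), Cseries_Re in H.
  replace (Im l) with (Re (- Ci * l))
    by (destruct l as [p q]; unfold Re, Im; simpl; ring).
  eapply is_series_ext; [|exact H]. intros n. cbv beta.
  destruct (u n) as [p q]. real_eq. unfold Re, Im. simpl. ring.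
Qed.

Lemma hardy_ip_series (w : nat -> R) (f g : dfun) :
  hardy w f -> hardy w g ->
  Cseries (fun k => (taylor f k * Cconj (taylor g k) * RtoC (beta w k ^ 2))%C)
    (hardy_ip w f g).
Proof.
  intros [_ Hf] [_ Hg].
  set (u := fun k => (taylor f k * Cconj (taylor g k) * RtoC (beta w k ^ 2))%C).
  destruct (Cseries_dominated u (fun k => Cmod (taylor f k) ^ 2 * beta w k ^ 2
    + Cmod (taylor g k) ^ 2 * beta w k ^ 2)) as [l Hl].
  - intros k. unfold u. rewrite !Cmod_mult, Cmod_conj, Cmod_R.
    rewrite Rabs_pos_eq by apply pow2_ge_0. rewrite <- Rmult_plus_distr_r.
    apply Rmult_le_compat_r; [apply pow2_ge_0|].
    assert (H := pow2_ge_0 (Cmod (taylor f k) - Cmod (taylor g k))).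
    assert (H1 := Cmod_ge_0 (taylor f k)). assert (H2 := Cmod_ge_0 (taylor g k)). nra.
  - apply (ex_series_plus (V := R_NormedModule)); assumption.
  - replace (hardy_ip w f g) with l; [exact Hl|].
    change (hardy_ip w f g)
      with (Series (fun k => Re (u k)), Series (fun k => Im (u k))).
    
    rewrite (is_series_unique _ _ (Cseries_Re u l Hl)).
    rewrite (is_series_unique _ _ (Cseries_Im u l Hl)).
    destruct l; reflexivity.
Qed.

Lemma hardy_plus (w : nat -> R) (f g : dfun) :
  hardy w f -> hardy w g -> hardy w (dplus f g) /\
  taylor (dplus f g) = (fun k => taylor f k + taylor g k)%C.
Proof.
  intros Hf Hg. assert (H := hardy_coef_plus w _ _ f g Hf Hg).
  split; [exact (hardy_coef_hardy _ _ _ H)|exact (hardy_coef_taylor _ _ _ H)].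
Qed.

Lemma hardy_scal (w : nat -> R) (a : C) (f : dfun) :
  hardy w f -> hardy w (dscal a f) /\
  taylor (dscal a f) = (fun k => a * taylor f k)%C.
Proof.
  intros Hf. assert (H := hardy_coef_scal w _ a f Hf).
  split; [exact (hardy_coef_hardy _ _ _ H)|exact (hardy_coef_taylor _ _ _ H)].
Qed.

Lemma dminus_scal (f g : dfun) (l : C) :
  dminus f (dscal l g) = dplus f (dscal (- l)%C g).
Proof.
  apply functional_extensionality; intros z.
  unfold dminus, dplus, dscal. ring.
Qed.

Lemma hardy_diag (w : nat -> R) (d : nat -> C) (M : R) (f : dfun) :
  is_weight w -> (forall k, Cmod (d k) <= M) -> hardy w f ->
  hardy w (diag_op d f) /\ taylor (diag_op d f) = (fun k => d k * taylor f k)%C.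
Proof.
  intros Hw Hd Hf. assert (H := hardy_coef_diag w _ d M f Hw Hd Hf).
  split; [exact (hardy_coef_hardy _ _ _ H)|exact (hardy_coef_taylor _ _ _ H)].
Qed.

Lemma hardy_eq (w : nat -> R) (f g : dfun) :
  hardy w f -> hardy w g -> taylor f = taylor g -> f = g.
Proof.
  intros [Hf _] [Hg _] H. rewrite H in Hf. exact (has_taylor_eq _ _ _ Hf Hg).
Qed.

Lemma hardy_ip_self (w : nat -> R) (f : dfun) :
  Re (hardy_ip w f f) = energy w (taylor f).
Proof.
  apply Series_ext. intros k. rewrite <- Cmod2_conj, <- RtoC_mult. reflexivity.
Qed.

Lemma hardy_inner_product (w : nat -> R) :
  is_weight w -> inner_product (hardy w) (hardy_ip w).
Proof.
  intros Hw. split; [|split; [|split; [|split]]].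
  - intros f g h Hf Hg Hh. destruct (hardy_plus w f g Hf Hg) as [Hfg Ht].
    eapply Cseries_unique; [apply hardy_ip_series; assumption|].
    rewrite Ht.
    eapply Cseries_ext; [|apply Cseries_plus; apply hardy_ip_series; eassumption].
    intros k; cbv beta; ring.
  - intros a f g Hf Hg. destruct (hardy_scal w a f Hf) as [Haf Ht].
    eapply Cseries_unique; [apply hardy_ip_series; assumption|].
    rewrite Ht.
    eapply Cseries_ext; [|apply (Cseries_scal a), hardy_ip_series; eassumption].
    intros k; cbv beta; ring.
  - intros f g _ _. unfold hardy_ip. apply injective_projections; cbn [fst snd Cconj].
    + apply Series_ext; intros k. simpl; ring.
    + rewrite <- Series_opp. apply Series_ext; intros k. simpl; ring.
  - intros f Hf. rewrite hardy_ip_self. apply energy_nonneg. apply Hf.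
  - intros f Hf H0. assert (HE := hardy_ip_self w f). rewrite H0 in HE.
    simpl in HE. apply (has_taylor_eq (taylor f)); [apply Hf|].
    replace (taylor f) with (fun _ : nat => RtoC 0).
    + apply has_taylor_Cseries. intros z.
      eapply Cseries_ext; [|exact Cseries_zero]. intros k; cbv beta; ring.
    + apply functional_extensionality; intros k. symmetry. apply Cmod_eq_0.
      assert (H := energy_term_le w (taylor f) k (proj2 Hf)). rewrite <- HE in H.
      assert (Hb := pow_lt _ 2 (beta_pos w k Hw)).
      assert (H' := Cmod_ge_0 (taylor f k)).
      destruct H' as [H'|H']; [|symmetry; exact H'].
      assert (0 < Cmod (taylor f k) ^ 2 * beta w k ^ 2); [|lra].
      apply Rmult_lt_0_compat; [apply pow_lt; exact H'|exact Hb].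
Qed.

(** * Normalized monomials and adjoints of diagonal operators *)

Lemma Cseries_single (u : nat -> C) (n : nat) :
  (forall k, k <> n -> u k = RtoC 0) -> Cseries u (u n).
Proof.
  revert u. induction n as [|n IH]; intros u Hu; apply Cseries_decr.
  - replace (u O - u O)%C with (RtoC 0) by ring.
    eapply Cseries_ext; [|exact Cseries_zero].
    intros k. symmetry. apply Hu. discriminate.
  - rewrite (Hu O) by discriminate.
    replace (u (S n) - 0)%C with (u (S n)) by ring.
    apply (IH (fun k => u (S k))). intros k Hk. apply Hu. lia.
Qed.

Definition monomial (w : nat -> R) (n : nat) : dfun :=
  fun z => (disk_val z ^ n * RtoC (/ beta w n))%C.

Definition monomial_coef (w : nat -> R) (n k : nat) : C :=
  if Nat.eqb k n then RtoC (/ beta w n) else RtoC 0.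

Lemma hardy_monomial (w : nat -> R) (n : nat) :
  hardy w (monomial w n) /\ taylor (monomial w n) = monomial_coef w n.
Proof.
  assert (H : hardy_coef w (monomial_coef w n) (monomial w n)).
  { split.
    - apply has_taylor_Cseries. intros z.
      replace (monomial w n z) with (disk_val z ^ n * monomial_coef w n n)%C.
      + apply (Cseries_single (fun k => disk_val z ^ k * monomial_coef w n k)%C).
        intros k Hk. unfold monomial_coef.
        destruct (Nat.eqb_spec k n); [contradiction|ring].
      + unfold monomial_coef. rewrite Nat.eqb_refl. reflexivity.
    - assert (Hs := Cseries_Re _ _ (Cseries_single
        (fun k => RtoC (Cmod (monomial_coef w n k) ^ 2 * beta w k ^ 2)) n
        ltac:(intros k Hk; unfold monomial_coef;
              destruct (Nat.eqb_spec k n); [contradiction|];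
              rewrite Cmod_0; f_equal; ring))).
      eexists. exact Hs. }
  split; [exact (hardy_coef_hardy _ _ _ H)|exact (hardy_coef_taylor _ _ _ H)].
Qed.

Lemma hardy_ip_monomial (w : nat -> R) (f : dfun) (n : nat) :
  is_weight w -> hardy w f ->
  hardy_ip w f (monomial w n) = (taylor f n * RtoC (beta w n))%C.
Proof.
  intros Hw Hf. destruct (hardy_monomial w n) as [Hm Ht].
  eapply Cseries_unique; [apply hardy_ip_series; assumption|].
  rewrite Ht.
  assert (Hb := beta_pos w n Hw).
  replace (taylor f n * RtoC (beta w n))%C
    with (taylor f n * Cconj (monomial_coef w n n) * RtoC (beta w n ^ 2))%C.
  - apply (Cseries_single
      (fun k => taylor f k * Cconj (monomial_coef w n k) * RtoC (beta w k ^ 2))%C).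
    intros k Hk. unfold monomial_coef. destruct (Nat.eqb_spec k n); [contradiction|].
    replace (Cconj (RtoC 0)) with (RtoC 0)
      by (rewrite Cconj_RtoC; reflexivity).
    ring.
  - unfold monomial_coef. rewrite Nat.eqb_refl.
    replace (Cconj (RtoC (/ beta w n))) with (RtoC (/ beta w n))
      by (rewrite Cconj_RtoC; reflexivity).
    rewrite <- Cmult_assoc, <- RtoC_mult. f_equal. f_equal. field. lra.
Qed.

Lemma hardy_ip_diag (w : nat -> R) (d : nat -> C) (M : R) (f g : dfun) :
  is_weight w -> (forall k, Cmod (d k) <= M) -> hardy w f -> hardy w g ->
  hardy_ip w (diag_op d f) g = hardy_ip w f (diag_op (fun k => Cconj (d k)) g).
Proof.
  intros Hw Hd Hf Hg.
  assert (Hd' : forall k, Cmod (Cconj (d k)) <= M)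
    by (intros k; rewrite Cmod_conj; apply Hd).
  destruct (hardy_diag w d M f Hw Hd Hf) as [_ H1].
  destruct (hardy_diag w _ M g Hw Hd' Hg) as [_ H2].
  unfold hardy_ip. rewrite H1, H2.
  f_equal; apply Series_ext; intros k; rewrite Cmult_conj, Cconj_conj;
    f_equal; ring.
Qed.

(** * Operators diagonalized by composition with the involution *)

Lemma hardy_norm_energy (w : nat -> R) (f : dfun) :
  hardy_norm w f = sqrt (energy w (taylor f)).
Proof. reflexivity. Qed.

Section Conjugation.

Context {w : nat -> R} {alpha : disk} {B : R}.
Hypothesis Hw : is_weight w.
Hypothesis B_pos : 0 < B.
Hypothesis psi_bounded : forall c f, hardy_coef w c f ->
  exists c', hardy_coef w c' (comp_op (psi_disk alpha) f)
    /\ energy w c' <= B * energy w c.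

Notation P := (comp_op (psi_disk alpha)).

(** The inner product for which composition with the involution is unitary onto the space with
    [hardy_ip]. *)
Definition pullback_ip (w : nat -> R) (alpha : disk) (f g : dfun) : C :=
  hardy_ip w (comp_op (psi_disk alpha) f) (comp_op (psi_disk alpha) g).

Definition conj_diag (alpha : disk) (d : nat -> C) (f : dfun) : dfun :=
  comp_op (psi_disk alpha) (diag_op d (comp_op (psi_disk alpha) f)).

Lemma hardy_psi (f : dfun) : hardy w f -> hardy w (P f).
Proof.
  intros Hf. destruct (psi_bounded _ f Hf) as [c' [H _]].
  exact (hardy_coef_hardy _ _ _ H).
Qed.

Lemma hardy_norm_psi (f : dfun) :
  hardy w f -> hardy_norm w (P f) <= sqrt B * hardy_norm w f.
Proof.
  intros Hf. destruct (psi_bounded _ f Hf) as [c' [H HE]].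
  rewrite !hardy_norm_energy, (hardy_coef_taylor _ _ _ H).
  rewrite <- sqrt_mult_alt by lra. apply sqrt_le_1_alt, HE.
Qed.

Lemma comp_psi_psi (f : dfun) : P (P f) = f.
Proof.
  apply functional_extensionality; intros z. unfold comp_op.
  rewrite psi_disk_involutive. reflexivity.
Qed.

Lemma pullback_norm (f : dfun) :
  ip_norm (pullback_ip w alpha) f = hardy_norm w (P f).
Proof.
  unfold ip_norm, pullback_ip. rewrite hardy_ip_self. reflexivity.
Qed.

(** One bound gives both inequalities: [P] is its own inverse, so the lower one is the upper one
    applied to [P f]. *)
Lemma pullback_equivalent :
  equivalent_norms (hardy w) (hardy_norm w) (ip_norm (pullback_ip w alpha)).
Proof.
  assert (Hs : 0 < sqrt B) by (apply sqrt_lt_R0, B_pos).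
  exists (/ sqrt B), (sqrt B). split; [apply Rinv_0_lt_compat, Hs|].
  split; [exact Hs|]. intros f Hf. rewrite pullback_norm.
  split; [|apply hardy_norm_psi, Hf].
  apply Rmult_le_reg_l with (sqrt B); [exact Hs|].
  rewrite <- Rmult_assoc, Rinv_r, Rmult_1_l by lra.
  rewrite <- (comp_psi_psi f) at 1. apply hardy_norm_psi, hardy_psi, Hf.
Qed.

Lemma pullback_inner_product : inner_product (hardy w) (pullback_ip w alpha).
Proof.
  destruct (hardy_inner_product w Hw) as [H1 [H2 [H3 [H4 H5]]]].
  unfold pullback_ip. split; [|split; [|split; [|split]]].
  - intros f g h Hf Hg Hh. apply (H1 (P f) (P g) (P h)); apply hardy_psi; assumption.
  - intros a f g Hf Hg. apply (H2 a (P f) (P g)); apply hardy_psi; assumption.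
  - intros f g Hf Hg. apply H3; apply hardy_psi; assumption.
  - intros f Hf. apply H4, hardy_psi, Hf.
  - intros f Hf H0. rewrite <- (comp_psi_psi f), (H5 (P f) (hardy_psi f Hf) H0).
    reflexivity.
Qed.

Lemma hardy_conj_diag (d : nat -> C) (M : R) (f : dfun) :
  (forall k, Cmod (d k) <= M) -> hardy w f -> hardy w (conj_diag alpha d f).
Proof.
  intros Hd Hf. apply hardy_psi. apply (hardy_diag w d M); trivial.
  apply hardy_psi, Hf.
Qed.

Lemma conj_diag_bounded (d : nat -> C) (M : R) :
  (forall k, Cmod (d k) <= M) ->
  bounded_op (hardy w) (hardy_norm w) (conj_diag alpha d).
Proof.
  intros Hd. assert (HD := fun f => hardy_diag w d M f Hw Hd).
  assert (HM : 0 <= M) by (eapply Rle_trans; [apply Cmod_ge_0|apply (Hd O)]).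
  split; [|split; [|split]].
  - intros f. apply (hardy_conj_diag d M f Hd).
  - intros f g Hf Hg. unfold conj_diag.
    apply hardy_psi in Hf, Hg.
    change (P (dplus f g)) with (dplus (P f) (P g)).
    destruct (hardy_plus w _ _ Hf Hg) as [Hs Hst].
    destruct (HD _ Hs) as [K1 T1]. destruct (HD _ Hf) as [K2 T2].
    destruct (HD _ Hg) as [K3 T3].
    destruct (hardy_plus w _ _ K2 K3) as [K4 T4].
    rewrite (hardy_eq w _ _ K1 K4); [reflexivity|].
    rewrite T1, T4, T2, T3, Hst. apply functional_extensionality; intros k. ring.
  - intros a f Hf. unfold conj_diag.
    apply hardy_psi in Hf.
    change (P (dscal a f)) with (dscal a (P f)).
    destruct (hardy_scal w a _ Hf) as [Hs Hst].
    destruct (HD _ Hs) as [K1 T1]. destruct (HD _ Hf) as [K2 T2].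
    destruct (hardy_scal w a _ K2) as [K4 T4].
    rewrite (hardy_eq w _ _ K1 K4); [reflexivity|].
    rewrite T1, T4, T2, Hst. apply functional_extensionality; intros k. ring.
  - exists (sqrt B * (M * sqrt B)). intros f Hf. unfold conj_diag.
    assert (HPf := hardy_psi f Hf). destruct (HD _ HPf) as [K1 T1].
    eapply Rle_trans; [apply hardy_norm_psi, K1|].
    rewrite !Rmult_assoc. apply Rmult_le_compat_l; [apply sqrt_pos|].
    apply Rle_trans with (M * hardy_norm w (P f)).
    + rewrite !hardy_norm_energy, T1.
      rewrite <- (sqrt_pow2 M) by exact HM.
      rewrite <- sqrt_mult_alt by apply pow2_ge_0. apply sqrt_le_1_alt.
      apply finite_energy_le; [|apply HPf].
      intros k. rewrite Cmod_mult.
      apply Rmult_le_compat_r; [apply Cmod_ge_0|apply Hd].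
    + apply Rmult_le_compat_l; [exact HM|]. apply hardy_norm_psi, Hf.
Qed.

(** The two inner compositions cancel, so [conj_diag] is multiplicative on bounded sequences.
    Commutation with the adjoint and inversion of [C_phi - l] thereby reduce to statements about
    numbers. *)
Lemma conj_diag_comp (d e : nat -> C) (M N : R) (f : dfun) :
  (forall k, Cmod (d k) <= M) -> (forall k, Cmod (e k) <= N) -> hardy w f ->
  conj_diag alpha d (conj_diag alpha e f) = conj_diag alpha (fun k => d k * e k)%C f.
Proof.
  intros Hd He Hf. unfold conj_diag. rewrite comp_psi_psi.
  assert (HPf := hardy_psi f Hf).
  assert (Hde : forall k, Cmod (d k * e k) <= M * N).
  { intros k. rewrite Cmod_mult.
    apply Rmult_le_compat; try apply Cmod_ge_0; [apply Hd|apply He]. }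
  destruct (hardy_diag w e N _ Hw He HPf) as [K1 T1].
  destruct (hardy_diag w d M _ Hw Hd K1) as [K2 T2].
  destruct (hardy_diag w _ (M * N) _ Hw Hde HPf) as [K3 T3].
  rewrite (hardy_eq w _ _ K2 K3); [reflexivity|].
  rewrite T2, T3, T1. apply functional_extensionality; intros k. ring.
Qed.

(** The scalar [l] is itself [conj_diag] of a constant sequence, once [f] is written as
    [P (P f)]. *)
Lemma conj_diag_shift (d : nat -> C) (M : R) (l : C) (f : dfun) :
  (forall k, Cmod (d k) <= M) -> hardy w f ->
  dminus (conj_diag alpha d f) (dscal l f)
  = conj_diag alpha (fun k => d k - l)%C f.
Proof.
  intros Hd Hf. assert (HPf := hardy_psi f Hf).
  assert (Hdl : forall k, Cmod (d k - l) <= M + Cmod l).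
  { intros k. eapply Rle_trans; [apply Cmod_triangle|].
    rewrite Cmod_opp. apply Rplus_le_compat_r, Hd. }
  destruct (hardy_diag w d M _ Hw Hd HPf) as [K1 T1].
  destruct (hardy_scal w (- l)%C _ HPf) as [K2 T2].
  destruct (hardy_plus w _ _ K1 K2) as [K3 T3].
  destruct (hardy_diag w _ (M + Cmod l) _ Hw Hdl HPf) as [K4 T4].
  rewrite dminus_scal. unfold conj_diag.
  rewrite <- (comp_psi_psi f) at 2.
  change (dplus (P (diag_op d (P f))) (dscal (- l)%C (P (P f))))
    with (P (dplus (diag_op d (P f)) (dscal (- l)%C (P f)))).
  rewrite (hardy_eq w _ _ K3 K4); [reflexivity|].
  rewrite T3, T4, T1, T2. apply functional_extensionality; intros k. ring.
Qed.

Lemma conj_diag_1 (d : nat -> C) (f : dfun) :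
  (forall k, d k = RtoC 1) -> hardy w f -> conj_diag alpha d f = f.
Proof.
  intros Hd Hf. assert (HPf := hardy_psi f Hf).
  assert (Hd1 : forall k, Cmod (d k) <= 1) by (intros k; rewrite Hd, Cmod_1; lra).
  destruct (hardy_diag w d 1 _ Hw Hd1 HPf) as [K1 T1].
  unfold conj_diag. rewrite (hardy_eq w _ _ K1 HPf); [apply comp_psi_psi|].
  rewrite T1. apply functional_extensionality; intros k. rewrite Hd. ring.
Qed.

Lemma conj_diag_adjoint (d : nat -> C) (M : R) (f g : dfun) :
  (forall k, Cmod (d k) <= M) -> hardy w f -> hardy w g ->
  pullback_ip w alpha (conj_diag alpha d f) g
  = pullback_ip w alpha f (conj_diag alpha (fun k => Cconj (d k)) g).
Proof.
  intros Hd Hf Hg. unfold pullback_ip, conj_diag. rewrite !comp_psi_psi.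
  apply (hardy_ip_diag w d M); try assumption; apply hardy_psi; assumption.
Qed.

(** These are the functions [psi^n / beta_n], the eigenfunctions of Koenigs type at the fixed point;
    [P] carries them back to normalized monomials. *)
Definition psi_basis (w : nat -> R) (alpha : disk) (n : nat) : dfun :=
  comp_op (psi_disk alpha) (monomial w n).

Lemma hardy_psi_basis (n : nat) : hardy w (psi_basis w alpha n).
Proof. apply hardy_psi, hardy_monomial. Qed.

Lemma psi_basis_orthonormal :
  orthonormal_basis (hardy w) (pullback_ip w alpha) (psi_basis w alpha).
Proof.
  assert (Hnz : forall n, RtoC (beta w n) <> RtoC 0).
  { intros n H. apply RtoC_inj in H. assert (Hb := beta_pos w n Hw). lra. }
  assert (Hip : forall m n, pullback_ip w alpha (psi_basis w alpha m) (psi_basis w alpha n)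
      = (monomial_coef w m n * RtoC (beta w n))%C).
  { intros m n. unfold pullback_ip, psi_basis. rewrite !comp_psi_psi.
    rewrite hardy_ip_monomial by (exact Hw || apply hardy_monomial).
    rewrite (proj2 (hardy_monomial w m)). reflexivity. }
  split; [|split; [|split]].
  - exact hardy_psi_basis.
  - intros n. rewrite Hip. unfold monomial_coef. rewrite Nat.eqb_refl.
    rewrite RtoC_inv by (apply Rgt_not_eq, beta_pos, Hw). apply Cinv_l, Hnz.
  - intros m n Hmn. rewrite Hip. unfold monomial_coef.
    destruct (Nat.eqb_spec n m); [congruence|ring].
  - intros f Hf H. assert (HPf := hardy_psi f Hf).
    rewrite <- (comp_psi_psi f).
    replace (P f) with dzero; [reflexivity|]. symmetry.
    apply (has_taylor_eq (taylor (P f))); [apply HPf|].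
    replace (taylor (P f)) with (fun _ : nat => RtoC 0).
    + apply has_taylor_Cseries. intros z.
      eapply Cseries_ext; [|exact Cseries_zero]. intros k; cbv beta; ring.
    + apply functional_extensionality; intros n. symmetry.
      assert (Hn := H n). unfold pullback_ip, psi_basis in Hn.
      rewrite comp_psi_psi, hardy_ip_monomial in Hn by assumption.
      replace (taylor (P f) n)
        with (taylor (P f) n * RtoC (beta w n) / RtoC (beta w n))%C
        by (field; apply Hnz).
      rewrite Hn. field. apply Hnz.
Qed.

Lemma conj_diag_basis (d : nat -> C) (M : R) (n : nat) :
  (forall k, Cmod (d k) <= M) ->
  conj_diag alpha d (psi_basis w alpha n) = dscal (d n) (psi_basis w alpha n).
Proof.
  intros Hd. unfold conj_diag, psi_basis. rewrite comp_psi_psi.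
  destruct (hardy_monomial w n) as [Hm Tm].
  destruct (hardy_diag w d M _ Hw Hd Hm) as [K1 T1].
  destruct (hardy_scal w (d n) _ Hm) as [K2 T2].
  rewrite (hardy_eq w _ _ K1 K2); [reflexivity|].
  rewrite T1, T2, Tm. apply functional_extensionality; intros k.
  unfold monomial_coef. destruct (Nat.eqb_spec k n) as [->|]; [reflexivity|ring].
Qed.

Lemma hardy_norm_basis_pos (n : nat) : 0 < hardy_norm w (psi_basis w alpha n).
Proof.
  destruct pullback_equivalent as [c [d [Hc [Hd H]]]].
  destruct (H _ (hardy_psi_basis n)) as [_ H2].
  assert (H1 : ip_norm (pullback_ip w alpha) (psi_basis w alpha n) = 1).
  { unfold ip_norm. rewrite (proj1 (proj2 psi_basis_orthonormal) n). exact sqrt_1. }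
  rewrite H1 in H2. nra.
Qed.

End Conjugation.

(** * Change of norm, rotations and the spectrum *)

Lemma bounded_op_equivalent (H : dfun -> Prop) (N1 N2 : dfun -> R)
    (T : dfun -> dfun) :
  (forall f, 0 <= N1 f) -> equivalent_norms H N1 N2 ->
  bounded_op H N1 T -> bounded_op H N2 T.
Proof.
  intros HN1 [c [d [Hc [Hd Heq]]]] [H1 [H2 [H3 [M HM]]]].
  split; [exact H1|]. split; [exact H2|]. split; [exact H3|].
  (* The bound [M] of [bounded_op] may be negative, hence [Rabs M]; the factors [d] and [1 / c] pay
     for the change of norm on the image and on the argument. *)
  exists (d * Rabs M / c). intros f Hf.
  destruct (Heq f Hf) as [Hf1 _]. destruct (Heq _ (H1 f Hf)) as [_ Hf2].
  eapply Rle_trans; [exact Hf2|].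
  apply Rle_trans with (d * (Rabs M * N1 f)).
  - apply Rmult_le_compat_l; [lra|]. eapply Rle_trans; [apply HM, Hf|].
    apply Rmult_le_compat_r; [apply HN1|apply Rle_abs].
  - replace (d * Rabs M / c * N2 f) with (d * (Rabs M * (N2 f / c))) by (field; lra).
    apply Rmult_le_compat_l; [lra|]. apply Rmult_le_compat_l; [apply Rabs_pos|].
    apply Rmult_le_reg_l with c; [exact Hc|].
    replace (c * (N2 f / c)) with (N2 f) by (field; lra). exact Hf1.
Qed.

Lemma Cmod_pow_1 (l : C) (n : nat) : Cmod l = 1 -> Cmod (l ^ n) = 1.
Proof. intros H. rewrite Cmod_pow, H. apply pow1. Qed.

(** Composition with the rotation by [l] multiplies the coefficient of index [n] by [l^n]. This
    links the geometry of [phi] with a diagonal operator. *)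
Lemma diag_op_rotation (w : nat -> R) (l : C) (f : dfun) (z z' : disk) :
  is_weight w -> Cmod l = 1 -> hardy w f ->
  disk_val z' = (l * disk_val z)%C ->
  diag_op (fun n => (l ^ n)%C) f z = f z'.
Proof.
  intros Hw Hl Hf Hz.
  assert (Hd : forall k, Cmod (l ^ k) <= 1) by (intros; rewrite Cmod_pow_1; [lra|exact Hl]).
  assert (H := hardy_coef_diag w _ _ 1 f Hw Hd Hf).
  eapply Cseries_unique; [apply (proj1 (has_taylor_Cseries _ _) (proj1 H) z)|].
  eapply Cseries_ext; [|apply (proj1 (has_taylor_Cseries _ _) (proj1 Hf) z')].
  intros k. cbv beta. rewrite Hz, Cpow_mult_l. ring.
Qed.

Theorem theorem3p7 :
  forall (w : nat -> R) (phi : disk -> disk) (alpha : disk),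
    is_weight w ->
    polynomial_growth w ->
    elliptic phi ->
    phi alpha = alpha ->
    bounded_op (hardy w) (hardy_norm w) (comp_op phi) /\
    (exists ip : dfun -> dfun -> C,
       inner_product (hardy w) ip /\
       equivalent_norms (hardy w) (hardy_norm w) (ip_norm ip) /\
       (disk_val alpha = RtoC 0 ->
          forall f g, hardy w f -> hardy w g -> ip f g = hardy_ip w f g) /\
       diagonal_op (hardy w) ip (comp_op phi) /\
       normal_op (hardy w) ip (comp_op phi)) /\
    (forall l : C,
       spectrum (hardy w) (hardy_norm w) (comp_op phi) l <->
       Cclosure
         (fun x => exists n : nat,
            x = Cpow (dderive (fun z => disk_val (phi z)) alpha) n) l).
Proof.
  intros w phi alpha Hw Hgrowth [theta [z0 [Haut _]]] Hfix.
  destruct (hardy_coef_psi w alpha Hw Hgrowth) as [B [HB Hpsi]].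
  rewrite (C_derive_mobius theta z0 phi alpha Haut Hfix).
  destruct Haut as [Hz0 Hphi].
  assert (Ha : Cmod alpha < 1) by exact (proj2_sig alpha).
  assert (Hfix' : mobius theta z0 alpha = alpha)
    by (rewrite <- Hphi, Hfix; reflexivity).
  set (lam := multiplier theta z0 alpha).
  assert (Hlam : Cmod lam = 1) by (apply Cmod_multiplier; assumption).
  set (d := fun n => (lam ^ n)%C).
  assert (Hd1 : forall n, Cmod (d n) = 1) by (intros n; apply Cmod_pow_1, Hlam).
  assert (Hd : forall n, Cmod (d n) <= 1) by (intros n; rewrite Hd1; lra).
  assert (Hlin : forall z, disk_val (psi_disk alpha (phi z))
            = (lam * disk_val (psi_disk alpha z))%C).
  { intros z. change (psi alpha (phi z) = (lam * psi alpha z)%C). rewrite Hphi.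
    apply psi_mobius; try assumption. exact (proj2_sig z). }
  (* Because [psi] is an involution, [phi z = psi (lam psi z)]: read on functions, this is the
     rotation multiplier conjugated by [P]. *)
  assert (HT : forall f, hardy w f -> comp_op phi f = conj_diag alpha d f).
  { intros f Hf. apply functional_extensionality; intros z.
    change (f (phi z) = diag_op (fun n => (lam ^ n)%C)
      (comp_op (psi_disk alpha) f) (psi_disk alpha z)).
    rewrite (diag_op_rotation w lam _ _ (psi_disk alpha (phi z)) Hw Hlam
      (hardy_psi Hpsi f Hf) (Hlin z)).
    unfold comp_op. rewrite psi_disk_involutive. reflexivity. }
  assert (HTb : bounded_op (hardy w) (hardy_norm w) (comp_op phi)).
  { destruct (conj_diag_bounded Hw HB Hpsi d 1 Hd) as [H1 [_ [_ [M HM]]]].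
    split; [intros f Hf; rewrite (HT f Hf); apply H1, Hf|].
    split; [reflexivity|]. split; [reflexivity|].
    exists M. intros f Hf. rewrite (HT f Hf). apply HM, Hf. }
  assert (Hequiv := pullback_equivalent HB Hpsi).
  assert (Hnorm0 : forall f, 0 <= hardy_norm w f) by (intros; apply sqrt_pos).
  assert (HTb' := bounded_op_equivalent _ _ _ _ Hnorm0 Hequiv HTb).
  split; [exact HTb|]. split.
  - exists (pullback_ip w alpha).
    split; [exact (pullback_inner_product Hw Hpsi)|]. split; [exact Hequiv|].
    split; [|split].
    + intros H0 f g Hf Hg.
      (* For [alpha = 0] the involution is [z |-> - z], so coefficients change by [(-1)^k], and
         these signs cancel in the inner product. *)
      assert (Hrot : forall f, hardy w f ->
        taylor (comp_op (psi_disk alpha) f) = (fun k => (-(1)) ^ k * taylor f k)%C).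
      { intros h Hh. apply has_taylor_taylor. apply has_taylor_Cseries. intros z.
        eapply Cseries_ext; [|apply (proj1 (has_taylor_Cseries _ _) (proj1 Hh))].
        intros k. cbv beta.
        replace (disk_val (psi_disk alpha z)) with (- (1) * disk_val z)%C.
        - rewrite Cpow_mult_l. ring.
        - change (- (1) * z = psi alpha z)%C. unfold psi. rewrite H0.
          replace (Cconj (RtoC 0)) with (RtoC 0)
            by (rewrite Cconj_RtoC; reflexivity).
          field. }
      unfold pullback_ip, hardy_ip. rewrite (Hrot f Hf), (Hrot g Hg).
      assert (Hs : forall k, ((-(1)) ^ k * Cconj ((-(1)) ^ k))%C = RtoC 1).
      { intros k. apply Cmod_1_conj, Cmod_pow_1, Cmod_m1. }
      f_equal; apply Series_ext; intros k; f_equal; rewrite Cmult_conj;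
        transitivity ((- (1)) ^ k * Cconj ((- (1)) ^ k)
          * (taylor f k * Cconj (taylor g k) * RtoC (beta w k ^ 2)))%C;
        [ring|rewrite Hs; ring|ring|rewrite Hs; ring].
    + split; [exact HTb'|].
      exists (psi_basis w alpha), d.
      split; [exact (psi_basis_orthonormal Hw Hpsi)|].
      intros n. rewrite (HT _ (hardy_psi_basis Hpsi n)).
      apply (conj_diag_basis Hw d 1 n Hd).
    + split; [exact HTb'|].
      (* For the transported inner product the adjoint is the multiplier by conjugates; it commutes
         with the operator because multiplication of sequences is commutative. *)
      set (d' := fun n => Cconj (d n)).
      assert (Hd' : forall n, Cmod (d' n) <= 1)
        by (intros n; unfold d'; rewrite Cmod_conj; apply Hd).
      exists (conj_diag alpha d').
      split; [|split].
      * exact (bounded_op_equivalent _ _ _ _ Hnorm0 Hequiv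
          (conj_diag_bounded Hw HB Hpsi d' 1 Hd')).
      * intros f g Hf Hg. rewrite (HT f Hf).
        exact (conj_diag_adjoint Hw Hpsi d 1 f g Hd Hf Hg).
      * intros f Hf.
        rewrite (HT _ (hardy_conj_diag Hw Hpsi d' 1 f Hd' Hf)), (HT f Hf).
        rewrite (conj_diag_comp Hw Hpsi d d' 1 1 f Hd Hd' Hf).
        rewrite (conj_diag_comp Hw Hpsi d' d 1 1 f Hd' Hd Hf).
        f_equal. apply functional_extensionality; intros k. ring.
  - intros l. split.
    + intros Hspec. apply NNPP. intros Hncl. apply Hspec.
      (* A point outside the closure stays at a uniform distance [eps] from all the powers, so the
         sequence [1 / (d_n - l)] is bounded by [1 / eps] and defines a bounded inverse. *)
      assert (Hgap : exists eps, 0 < eps /\ forall n, eps <= Cmod (d n - l)).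
      { apply not_all_ex_not in Hncl. destruct Hncl as [eps Heps].
        apply imply_to_and in Heps. destruct Heps as [Heps Hn].
        exists eps. split; [exact Heps|]. intros n. apply Rnot_lt_le. intros Hlt.
        apply Hn. exists (d n). split; [exists n; reflexivity|exact Hlt]. }
      destruct Hgap as [eps [Heps Hgap]].
      assert (Hnz : forall n, (d n - l)%C <> RtoC 0).
      { intros n H. assert (Hn := Hgap n). rewrite H, Cmod_0 in Hn. lra. }
      set (s := fun n => (/ (d n - l))%C).
      assert (Hs : forall n, Cmod (s n) <= / eps).
      { intros n. unfold s. rewrite Cmod_inv by apply Hnz.
        apply Rinv_le_contravar; [exact Heps|apply Hgap]. }
      assert (Hdl : forall n, Cmod (d n - l) <= 1 + Cmod l).
      { intros n. eapply Rle_trans; [apply Cmod_triangle|].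
        rewrite Cmod_opp, Hd1. lra. }
      exists (conj_diag alpha s).
      split; [exact (conj_diag_bounded Hw HB Hpsi s (/ eps) Hs)|]. split.
      * intros f Hf. rewrite (HT f Hf), (conj_diag_shift Hw Hpsi d 1 l f Hd Hf).
        rewrite (conj_diag_comp Hw Hpsi s _ (/ eps) (1 + Cmod l) f Hs Hdl Hf).
        apply (conj_diag_1 Hw Hpsi); [|exact Hf].
        intros n. apply Cinv_l, Hnz.
      * intros f Hf.
        assert (HSf := hardy_conj_diag Hw Hpsi s (/ eps) f Hs Hf).
        rewrite (HT _ HSf), (conj_diag_shift Hw Hpsi d 1 l _ Hd HSf).
        rewrite (conj_diag_comp Hw Hpsi _ s (1 + Cmod l) (/ eps) f Hdl Hs Hf).
        apply (conj_diag_1 Hw Hpsi); [|exact Hf].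
        intros n. apply Cinv_r, Hnz.
    + intros Hcl [S [[_ [_ [HSscal [M HM]]]] [HS _]]].
      (* Conversely, a bounded inverse would send [(d_n - l) e] to the eigenvector [e], so
         [||e|| <= |M| |d_n - l| ||e||]. Choosing [|d_n - l|] below [1 / (|M| + 1)] contradicts
         [||e|| > 0]; the [+ 1] keeps this radius defined when [M = 0]. *)
      assert (HMp : 0 < Rabs M + 1) by (assert (H := Rabs_pos M); lra).
      destruct (Hcl (/ (Rabs M + 1))) as [x [[n ->] Hn]];
        [apply Rinv_0_lt_compat, HMp|].
      fold (d n) in Hn.
      set (e := psi_basis w alpha n).
      assert (He : hardy w e) by exact (hardy_psi_basis Hpsi n).
      assert (Hpos : 0 < hardy_norm w e) by exact (hardy_norm_basis_pos Hw HB Hpsi n).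
      assert (HSe := HS e He).
      replace (dminus (comp_op phi e) (dscal l e)) with (dscal (d n - l)%C e) in HSe.
      2:{ rewrite (HT e He). unfold e. rewrite (conj_diag_basis Hw d 1 n Hd).
          apply functional_extensionality; intros z.
          unfold dminus, dscal. ring. }
      assert (HMe := HM _ (proj1 (hardy_scal w (d n - l)%C e He))).
      rewrite HSe in HMe.
      assert (Hsc : hardy_norm w (dscal (d n - l)%C e)
                    <= Cmod (d n - l) * hardy_norm w e).
      { rewrite !hardy_norm_energy, (proj2 (hardy_scal w _ e He)).
        rewrite <- (sqrt_pow2 (Cmod (d n - l))) by apply Cmod_ge_0.
        rewrite <- sqrt_mult_alt by apply pow2_ge_0. apply sqrt_le_1_alt.
        apply finite_energy_le; [|apply He].
        intros k. rewrite Cmod_mult. lra. }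
      assert (H1 : hardy_norm w e <= Rabs M * (Cmod (d n - l) * hardy_norm w e)).
      { eapply Rle_trans; [exact HMe|].
        apply Rle_trans with (Rabs M * hardy_norm w (dscal (d n - l)%C e)).
        - apply Rmult_le_compat_r; [apply Hnorm0|apply Rle_abs].
        - apply Rmult_le_compat_l; [apply Rabs_pos|exact Hsc]. }
      assert (H2 : Rabs M * Cmod (d n - l) < 1).
      { apply Rle_lt_trans with ((Rabs M) * / (Rabs M + 1)).
        - apply Rmult_le_compat_l; [apply Rabs_pos|lra].
        - apply Rmult_lt_reg_r with (Rabs M + 1); [exact HMp|].
          rewrite Rmult_assoc, Rinv_l by lra. lra. }
      rewrite <- Rmult_assoc in H1. nra.
Qed.
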